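(* Let $q\ge 2$ be any integer and let $R$ be the reals or any totally ordered semi-ring. Over $R$, neither the family $\mathsf{Sat^q}=(\mathsf{Sat^q}_n)$ nor the family $\mathsf{Clow^q}=(\mathsf{Clow^q}_n)$ is a monotone affine $p$-projection of the permanent family $(\mathsf{Perm}_n)$. More precisely, any monotone affine projection from the permanent family to $\mathsf{Sat^q}$ must have blow-up at least $2^{\Omega(\sqrt n)}$, and any monotone affine projection from the permanent family to $\mathsf{Clow^q}$ must have blow-up at least $2^{\Omega(n)}$. Here: $\mathsf{Sat^q}_n=\sum_{a\in\{0,1\}^n}\big(\prod_{i:a_i=1}X_i^{q-1}\big)\big(\prod_{c\in\mathsf{Cl}_n:\ a\text{ satisfies }c}Y_c^{q-1}\big)$, where $\mathsf{Cl}_n$ is the set of all 3-literal clauses over the literals $x_1,\dots,x_n,\bar x_1,\dots,\bar x_n$, with variables $X_1,\dots,X_n$ and $Y_c$ ($c\in\mathsf{Cl}_n$). With $K_n$ the complete graph on $\{1,\dots,n\}$, variables $X_e$ (edges) and $Y_v$ (vertices), $\mathsf{Clow^q}_n=\sum_{w}\big(\prod_{i\in[n]}X_{\{v_{i-1},v_{i\bmod n}\}}^{q-1}\big)\big(\prod_{v\in\{v_0,\dots,v_{n-1}\}}Y_v^{q-1}\big)$, the sum over all closed walks $w=\langle v_0,\dots,v_{n-1}\rangle$ of length $n$ in $K_n$ with $v_0<v_j$ for all $j>0$ (edges repeated in $w$ contribute with multiplicity, each visited vertex contributes $Y_v^{q-1}$ once). $\mathsf{Perm}_n=\sum_{\sigma\in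 S_n}\prod_{i=1}^n y_{i,\sigma(i)}$.
   Context: A polynomial $f(x_1,\dots,x_n)$ is an affine projection of $g(y_1,\dots,y_m)$ if $f$ is obtained from $g$ by replacing each $y_i$ by an affine linear function $\ell_i(x_1,\dots,x_n)$. Over a totally ordered semi-ring, a monotone (affine) projection is one in which all constants appearing in the substitution are non-negative. The family $(f_n)$ is a monotone affine projection of $(g_n)$ with blow-up $t(n)$ if for all sufficiently large $n$, $f_n$ is a monotone affine projection of $g_{t(n)}$; it is a monotone affine $p$-projection if this holds with $t$ polynomially bounded. *)

(* Defs.v *)
From mathcomp Require Import all_boot all_order all_algebra all_fingroup.
From Stdlib Require Reals.

Set Implicit Arguments.
Unset Strict Implicit.
Unset Printing Implicit Defensive.

Import GRing.Theory.
Local Open Scope ring_scope.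

Definition totally_ordered_semiring (S : comNzSemiRingType)
    (le : S -> S -> Prop) : Prop :=
  (forall x, le x x) /\
  (forall x y, le x y -> le y x -> x = y) /\
  (forall x y z, le x y -> le y z -> le x z) /\
  (forall x y, le x y \/ le y x) /\
  (forall x y z, le x y -> le (x + z) (y + z)) /\
  (forall x y z, le x y -> le 0 z -> le (x * z) (y * z)).

(* Formal polynomials over S in a finite set V of variables, encoded   *)
(* as coefficient functions on monomials (exponent vectors).  Sums and *)
(* products are the usual formal (coefficientwise / Cauchy) ones.      *)
Section FormalPoly.
Variables (S : comNzSemiRingType) (V : finType).

Definition mon := {ffun V -> nat}.
Definition fpoly := mon -> S.

Definition mon0 : mon := [ffun _ => 0%N].
Definition monX (v : V) : mon := [ffun w => nat_of_bool (w == v)].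

Definition fp0 : fpoly := fun _ => 0.
Definition fpC (a : S) : fpoly := fun m => if m == mon0 then a else 0.
Definition fpX (v : V) : fpoly := fun m => if m == monX v then 1 else 0.
Definition fpadd (p q : fpoly) : fpoly := fun m => p m + q m.
(* (p*q)_m = sum over m1 <= m (pointwise) of p_m1 * q_(m - m1) *)
Definition fpmul (p q : fpoly) : fpoly := fun m =>
  \sum_(d : {ffun V -> 'I_(\sum_(v : V) m v).+1} | [forall v, d v <= m v]%N)
     p [ffun v => nat_of_ord (d v)] * q [ffun v => (m v - d v)%N].
Definition fp1 : fpoly := fpC 1.
Definition fpexp (p : fpoly) (k : nat) : fpoly := iter k (fpmul p) fp1.

Definition deg_le (g : fpoly) (d : nat) : Prop :=
  forall M : mon, (d < \sum_(v : V) M v)%N -> g M = 0.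

End FormalPoly.

Arguments fp0 {S V}.
Arguments fp1 {S V}.
Arguments fpX {S V}.
Arguments fpC {S V}.

(* Substitution: g(y_w := l_w) for g of total degree at most d *)
Definition fpsubst (S : comNzSemiRingType) (V W : finType) (d : nat)
    (g : fpoly S W) (l : W -> fpoly S V) : fpoly S V :=
  \big[@fpadd S V/fp0]_(M : {ffun W -> 'I_d.+1})
     fpmul (fpC (g [ffun w => nat_of_ord (M w)]))
           (\big[@fpmul S V/fp1]_(w : W) fpexp (l w) (M w)).

Definition fpaff (S : comNzSemiRingType) (V W : finType)
    (a : W -> S) (b : W -> V -> S) (w : W) : fpoly S V :=
  fpadd (fpC (a w)) (\big[@fpadd S V/fp0]_(v : V) fpmul (fpC (b w v)) (fpX v)).

Definition mono_aff_proj (S : comNzSemiRingType) (le : S -> S -> Prop)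
    (V W : finType) (f : fpoly S V) (g : fpoly S W) : Prop :=
  exists d, deg_le g d /\
  exists (a : W -> S) (b : W -> V -> S),
    (forall w, le 0 (a w)) /\ (forall w v, le 0 (b w v)) /\
    forall M, f M = fpsubst d g (fpaff a b) M.

Definition Permanent (S : comNzSemiRingType) (m : nat) : fpoly S ('I_m * 'I_m)%type :=
  \big[@fpadd _ _/fp0]_(s : 'S_m) \big[@fpmul _ _/fp1]_(i < m) fpX (i, s i).

(* Sat^q_n.  A literal is a pair (i, b): (i, true) = x_i, (i, false) = ~x_i.
   A 3-literal clause is a set of exactly 3 literals. *)
Definition lit (n : nat) := ('I_n * bool)%type.
Definition clause (n : nat) := {c : {set lit n} | #|c| == 3%N}.
Definition satisfies (n : nat) (a : {ffun 'I_n -> bool}) (c : clause n) : bool :=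
  [exists l in val c, a l.1 == l.2].
Definition sat_var (n : nat) := ('I_n + clause n)%type.

Definition Sat (S : comNzSemiRingType) (q n : nat) : fpoly S (sat_var n) :=
  \big[@fpadd _ _/fp0]_(a : {ffun 'I_n -> bool})
    fpmul (\big[@fpmul _ _/fp1]_(i | a i) fpexp (fpX (inl i)) (q - 1))
          (\big[@fpmul _ _/fp1]_(c : clause n | satisfies a c)
               fpexp (fpX (inr c)) (q - 1)).

(* Clow^q_n.  Edges of K_n are the 2-element subsets of 'I_n; variables
   X_e (edges) and Y_v (vertices). A closed walk <v_0,...,v_(n-1)> of
   length n is w : 'I_n -> 'I_n with v_i != v_(i+1 mod n); we require
   v_0 < v_j for all j > 0. *)
Definition edge (n : nat) := {e : {set 'I_n} | #|e| == 2%N}.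
Definition clow_var (n : nat) := (edge n + 'I_n)%type.

Definition closed_walk (n : nat) (w : {ffun 'I_n -> 'I_n}) : bool :=
  [forall i, w i != w (ordS i)].
Definition min_start (n : nat) (w : {ffun 'I_n -> 'I_n}) : bool :=
  [forall j : 'I_n, forall k : 'I_n,
     ((nat_of_ord k == 0%N) && (nat_of_ord j != 0%N)) ==> (w k < w j)%N].

Definition edgeX (S : comNzSemiRingType) (n : nat) (x y : 'I_n)
    : fpoly S (clow_var n) :=
  match insub [set x; y] : option (edge n) with
  | Some e => fpX (inl e)
  | None => fp0
  end.

Definition Clow (S : comNzSemiRingType) (q n : nat) : fpoly S (clow_var n) :=
  \big[@fpadd _ _/fp0]_(w : {ffun 'I_n -> 'I_n} | closed_walk w && min_start w)
    fpmul (\big[@fpmul _ _/fp1]_(i : 'I_n) fpexp (edgeX S (w i) (w (ordS i))) (q - 1))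
          (\big[@fpmul _ _/fp1]_(v : 'I_n | v \in codom w)
               fpexp (fpX (inr v)) (q - 1)).

Definition eventually (P : nat -> Prop) : Prop :=
  exists N, forall n, (N <= n)%N -> P n.

Definition poly_bounded (t : nat -> nat) : Prop :=
  exists k C : nat, forall n, (t n <= C * n ^ k + C)%N.

Definition pow2_le (x : Rdefinitions.R) (m : nat) : Prop :=
  Rdefinitions.Rle (Rpower.Rpower (Raxioms.INR 2) x) (Raxioms.INR m).

Definition Rpos (c : Rdefinitions.R) : Prop :=
  Rdefinitions.Rlt (Raxioms.INR 0) c.

Arguments Permanent : clear implicits.
Arguments Sat : clear implicits.
Arguments Clow : clear implicits.

(* Main.v *)
Require Import Defs.
From mathcomp Require Import all_boot all_order all_algebra all_fingroup.
From mathcomp Require Import zify.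
From Stdlib Require Import Classical_Prop Lra.
From Stdlib Require Reals.
Set Implicit Arguments.
Unset Strict Implicit.
Unset Printing Implicit Defensive.

Import Order.TTheory GRing.Theory Num.Theory.
Local Open Scope ring_scope.

(** Fix matchings realising the permanent: after discarding nilpotent
    coefficients, a projection of [Perm_m] is a set of labelled edges of an
    [m] by [m] bipartite graph whose perfect matchings spell exactly the
    monomials of [f].  Suppose a face of the Newton polytope of [f] consists of
    monomials containing a variable [z] and none of the [k * k] variables
    [rho (i, j)], together with monomials without [z] in which the [rho (i, j)]
    form a [k] by [k] permutation matrix.  Take a matching [N0] of the first
    kind and a row [i0] that it labels [z].  A matching of the second kind
    differs from [N0] by alternating cycles, and the cycle through [i0] carries
    all its [rho] labels, since swapping only the other cycles keeps [z].  So it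
    is a closed walk through [i0] on [m] vertices; cut it at the vertex [v]
    where exactly [j] rows of the permutation matrix have been met.  If two
    permutations are cut at the same [v], the crossed walks have the same
    weight, hence are tight, and the simple cycle through [i0] they contain is
    again a matching of the face.  This forces the two permutations to map the
    same [j]-set onto the same [j]-set, so each [v] serves at most
    [j! (k - j)!] of them and [m >= 'C(k, j)].

    [Sat] has such a face with [k] of order [sqrt n] (weights on clauses select
    the models of a CNF), and [Clow] has one with [k] of order [n]. *)

(** * Supports of formal polynomials *)

(* Exchanging edges between matchings needs products of coefficients to stay
   nonzero, but an ordered semiring may have zero divisors: [good] abstracts
   "nonnegative and not nilpotent". *)
Record positivity (S : comNzSemiRingType) (nn good : S -> Prop) : Prop := {
  pos_nn0 : nn 0;
  pos_nn1 : nn 1;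
  pos_nnD : forall x y, nn x -> nn y -> nn (x + y);
  pos_nnM : forall x y, nn x -> nn y -> nn (x * y);
  pos_0 : ~ good 0;
  pos_1 : good 1;
  pos_D : forall x y, nn x -> nn y -> (good (x + y) <-> good x \/ good y);
  pos_M : forall x y, nn x -> nn y -> (good (x * y) <-> good x /\ good y) }.

Section Support.
Variables (S : comNzSemiRingType) (nn good : S -> Prop).
Hypothesis pos : positivity nn good.

(** Requiring [nn] of every coefficient rules out cancellation, so sums and products of polynomials
    act on supports by union and Minkowski sum. *)
Definition has_support (V : finType) (p : fpoly S V) (A : mon V -> Prop) :=
  forall M, nn (p M) /\ (good (p M) <-> A M).

Lemma has_support_eq (V : finType) (p : fpoly S V) (A B : mon V -> Prop) :
  (forall M, A M <-> B M) -> has_support p A -> has_support p B.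
Proof. by move=> AB hp M; have [? ?] := hp M; rewrite -AB. Qed.

Lemma sum_good (I : Type) (r : seq I) (P : pred I) (F : I -> S) :
  (forall i, P i -> nn (F i)) ->
  nn (\sum_(i <- r | P i) F i) /\
  (good (\sum_(i <- r | P i) F i) <->
   exists2 i, List.In i r /\ P i & good (F i)).
Proof.
move=> hF; elim: r => [|i r [IHn IH]].
  rewrite big_nil; split; first exact: pos_nn0 pos.
  by split=> [g0|[i []]]; [case: (pos_0 pos g0)|].
rewrite big_cons; case: ifP => Pi; last first.
  split=> //; rewrite IH; split=> [[j [jr Pj] gj]|[j [[ij|jr] Pj] gj]].
  - by exists j => //; split=> //; right.
  - by rewrite -ij Pi in Pj.
  - by exists j.
split; first by exact: (pos_nnD pos) (hF _ Pi) IHn.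
rewrite (pos_D pos) ?IH //; last exact: hF.
split=> [[gi|[j [jr Pj] gj]]|[j [[ij|jr] Pj] gj]].
- by exists i => //; split=> //; left.
- by exists j => //; split=> //; right.
- by left; rewrite ij.
- by right; exists j.
Qed.

Lemma sum_goodT (I : finType) (P : pred I) (F : I -> S) :
  (forall i, P i -> nn (F i)) ->
  nn (\sum_(i | P i) F i) /\
  (good (\sum_(i | P i) F i) <-> exists2 i, P i & good (F i)).
Proof.
move=> hF; have [hn hg] := sum_good (index_enum I) hF; split=> //.
rewrite hg; split=> [[i [_ Pi] gi]|[i Pi gi]]; exists i => //; split=> //.
have := mem_index_enum i; elim: (index_enum I) => //= j r IH.
by rewrite inE => /orP[/eqP->|/IH]; [left|right].
Qed.

Section Ops.
Variable V : finType.
Implicit Types (p q : fpoly S V) (A B : mon V -> Prop).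

Lemma support_indicator (M0 : mon V) a : nn a ->
  has_support (fun M => if M == M0 then a else 0) (fun M => M = M0 /\ good a).
Proof.
move=> na M; case: eqP => [->|neq]; first by split=> //; split=> // [[]].
by split; [exact: pos_nn0 pos|split=> [g0|[]//]; case: (pos_0 pos g0)].
Qed.

Lemma mon0E : mon0 V = 0.
Proof. by apply/ffunP=> v; rewrite !ffunE. Qed.

Lemma supportC a : nn a -> has_support (fpC a) (fun M : mon V => M = 0 /\ good a).
Proof. by rewrite -mon0E; apply: support_indicator. Qed.

Lemma support1 : has_support (@fp1 S V) (fun M => M = 0).
Proof.
apply: has_support_eq (supportC (pos_nn1 pos)) => M.
by split=> [[]|->]//; split=> //; apply: pos_1 pos.
Qed.

Lemma supportX v : has_support (@fpX S V v) (fun M => M = monX v).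
Proof.
apply: has_support_eq (support_indicator (monX v) (pos_nn1 pos)) => M.
by split=> [[]|->]//; split=> //; apply: pos_1 pos.
Qed.

Lemma support_add p q A B : has_support p A -> has_support q B ->
  has_support (fpadd p q) (fun M => A M \/ B M).
Proof.
move=> hp hq M; have [np gp] := hp M; have [nq gq] := hq M.
by split; [exact: (pos_nnD pos)|rewrite (pos_D pos) // gp gq].
Qed.

Lemma support_mul p q A B : has_support p A -> has_support q B ->
  has_support (fpmul p q)
    (fun M => exists M1 M2 : mon V, [/\ A M1, B M2 & M = M1 + M2]).
Proof.
move=> hp hq M; rewrite /fpmul.
have [hn hg] := @sum_goodT {ffun V -> 'I_(\sum_(v : V) M v).+1}
  (fun d => [forall v, d v <= M v]%N)
  (fun d => p [ffun v => nat_of_ord (d v)] * q [ffun v => (M v - d v)%N])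
  (fun d _ => pos_nnM pos (hp _).1 (hq _).1).
split=> //; rewrite hg; split.
  move=> [d /forallP dM]; have [n1 g1] := hp [ffun v => nat_of_ord (d v)].
  have [n2 g2] := hq [ffun v => (M v - d v)%N].
  rewrite (pos_M pos) // g1 g2 => -[A1 B2].
  exists [ffun v => nat_of_ord (d v)], [ffun v => (M v - d v)%N]; split=> //.
  by apply/ffunP=> v; rewrite !ffunE /= addrC; apply/esym/subnK.
move=> [M1 [M2 [A1 B2 defM]]].
have M1M v : (M1 v <= M v)%N by rewrite defM ffunE leq_addr.
have M1b v : (M1 v < (\sum_(v : V) M v).+1)%N.
  by rewrite ltnS (leq_trans (M1M v)) // (bigD1 v) //= leq_addr.
exists [ffun v => Ordinal (M1b v)].
  by apply/forallP=> v; rewrite ffunE /=.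
rewrite (_ : [ffun v => _] = M1); last by apply/ffunP=> v; rewrite !ffunE.
rewrite (_ : [ffun v => _] = M2); last first.
  by apply/ffunP=> v; rewrite !ffunE /= defM !ffunE; apply: addKn.
have [n1 g1] := hp M1; have [n2 g2] := hq M2.
by rewrite (pos_M pos) // g1 g2.
Qed.

Lemma support_sum (I : finType) (P : pred I) (p : I -> fpoly S V)
    (A : I -> mon V -> Prop) :
  (forall i, P i -> has_support (p i) (A i)) ->
  has_support (\big[@fpadd S V/fp0]_(i | P i) p i)
    (fun M => exists2 i, P i & A i M).
Proof.
move=> hp.
have E M : (\big[@fpadd S V/fp0]_(i | P i) p i) M = \sum_(i | P i) p i M.
  by elim/big_rec2: _ => // i x y _ <-.
move=> M; rewrite E.
have [hn hg] := sum_goodT (fun i (Pi : P i) => (hp i Pi M).1).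
split=> //; rewrite hg; split=> -[i Pi Hi]; exists i => //.
  by apply/(hp i Pi M).2.
exact/(hp i Pi M).2.
Qed.

Lemma support_prod (I : finType) (P : pred I) (p : I -> fpoly S V)
    (A : I -> mon V -> Prop) :
  (forall i, P i -> has_support (p i) (A i)) ->
  has_support (\big[@fpmul S V/fp1]_(i | P i) p i)
    (fun M => exists2 mu : I -> mon V,
       forall i, P i -> A i (mu i) & M = \sum_(i | P i) mu i).
Proof.
move=> hp; have := index_enum_uniq I.
suff H r : uniq r -> has_support (\big[@fpmul S V/fp1]_(i <- r | P i) p i)
    (fun M => exists2 mu : I -> mon V,
       forall i, i \in r -> P i -> A i (mu i) & M = \sum_(i <- r | P i) mu i).
  move/H; apply: has_support_eq => M; split=> -[mu h1 h2]; exists mu => //.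
  by move=> i Pi; apply: h1; rewrite ?mem_index_enum.
  by move=> i _; apply: h1.
elim: r => [|i r IH] /=.
  move=> _; rewrite big_nil; apply: has_support_eq support1 => M.
  split=> [->|[mu _ ->]]; last by rewrite big_nil.
  by exists (fun=> 0); rewrite ?big_nil.
move=> /andP[ir /IH {}IH]; rewrite big_cons; case: ifP => Pi; last first.
  apply: has_support_eq IH => M.
  split=> -[mu h1 h2]; exists mu; rewrite ?big_cons ?Pi //.
  - move=> j; rewrite inE => /predU1P[->|/h1//]; by rewrite Pi.
  - by move=> j jr; apply: h1; rewrite inE jr orbT.
  - by move: h2; rewrite big_cons Pi.
apply: has_support_eq (support_mul (hp _ Pi) IH) => M; split.
  move=> [M1 [M2 [A1 [mu h1 h2] ->]]].
  exists (fun j => if j == i then M1 else mu j).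
    move=> j; rewrite inE; case: eqP => [->|_] //=; exact: h1.
  rewrite big_cons Pi eqxx h2; congr (_ + _).
  rewrite big_seq_cond [RHS]big_seq_cond; apply: eq_bigr => j /andP[jr _].
  by case: eqP jr => // ->; rewrite (negPf ir).
move=> [mu h1]; rewrite big_cons Pi => ->.
exists (mu i), (\sum_(j <- r | P j) mu j); split=> //.
  by apply: h1; rewrite ?mem_head.
by exists mu => // j jr; apply: h1; rewrite inE jr orbT.
Qed.

Lemma support_mono_mul p q M1 M2 : has_support p (eq^~ M1) ->
  has_support q (eq^~ M2) -> has_support (fpmul p q) (eq^~ (M1 + M2)).
Proof.
move=> hp hq; apply: has_support_eq (support_mul hp hq) => M.
by split=> [[? [? [-> -> ->]]]//|->]; exists M1, M2.
Qed.

Lemma support_mono_prod (I : finType) (P : pred I) (p : I -> fpoly S V) 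
    (mu : I -> mon V) : (forall i, P i -> has_support (p i) (eq^~ (mu i))) ->
  has_support (\big[@fpmul S V/fp1]_(i | P i) p i)
    (eq^~ (\sum_(i | P i) mu i)).
Proof.
move=> hp; apply: has_support_eq (support_prod hp) => M.
split=> [[nu h ->]|->]; last by exists mu.
exact: eq_bigr.
Qed.

Lemma support_exp p A n : has_support p A ->
  has_support (fpexp p n)
    (fun M => exists2 mu : 'I_n -> mon V, forall i, A (mu i) & M = \sum_i mu i).
Proof.
move=> hp; elim: n => [|n IH].
  apply: has_support_eq support1 => M.
  split=> [->|[mu _ ->]]; last by rewrite big_ord0.
  by exists (fun=> 0); [case|rewrite big_ord0].
apply: has_support_eq (support_mul hp IH) => M; split.
  move=> [M1 [M2 [A1 [mu h ->] ->]]].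
  exists (fun i => if unlift ord0 i is Some j then mu j else M1).
    by move=> i; case: unliftP => [j _|_].
  rewrite big_ord_recl unlift_none; congr (_ + _).
  by apply: eq_bigr => i _; rewrite liftK.
move=> [mu h ->]; exists (mu ord0), (\sum_i mu (lift ord0 i)).
by rewrite big_ord_recl; split=> //; exists (fun i => mu (lift ord0 i)).
Qed.

Lemma support_mono_exp p M0 n : has_support p (eq^~ M0) ->
  has_support (fpexp p n) (eq^~ (M0 *+ n)).
Proof.
move=> hp; elim: n => [|n IH]; first by rewrite mulr0n; apply: support1.
by rewrite mulrS; apply: support_mono_mul.
Qed.

End Ops.

(** [None] is the constant term of an affine form, which contributes the monomial 1. *)
Definition lab (V : finType) (o : option V) : mon V :=
  if o is Some v then monX v else 0.

Lemma support_perm m : has_support (Permanent S m)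
  (fun M => exists s : 'S_m, M = \sum_(i < m) monX (i, s i)).
Proof.
have H (s : 'S_m) : true -> has_support (\big[@fpmul _ _/fp1]_(i < m) fpX (i, s i))
    (eq^~ (\sum_(i < m) monX (i, s i))).
  by move=> _; apply: support_mono_prod => i _; apply: supportX.
apply: has_support_eq (support_sum H) => M.
by split=> [[s _ ->]|[s ->]]; exists s.
Qed.

Lemma monXE (V : finType) (v w : V) : monX v w = (w == v).
Proof. by rewrite ffunE. Qed.

Lemma mon_sumE (V I : finType) (P : pred I) (mu : I -> mon V) v :
  (\sum_(i | P i) mu i) v = (\sum_(i | P i) mu i v)%N.
Proof. by elim/big_rec2: _ => [|i x y _ <-]; rewrite !ffunE. Qed.

Lemma mon_mulnE (V : finType) (M : mon V) n v : (M *+ n) v = (M v * n)%N.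
Proof.
elim: n => [|n IH]; first by rewrite mulr0n ffunE muln0.
by rewrite mulrS ffunE IH mulnS.
Qed.

Lemma perm_monE m (s : 'S_m) (w : 'I_m * 'I_m) :
  (\sum_(i < m) monX (i, s i)) w = (w.2 == s w.1).
Proof.
case: w => i j; rewrite mon_sumE (bigD1 i) //= monXE xpair_eqE eqxx /=.
rewrite big1 ?addn0 // => l neq; rewrite monXE xpair_eqE.
by rewrite eq_sym (negPf neq).
Qed.

(** Expanding the product for one permutation [s] selects from each substituted entry [(i, s i)]
    either its constant or one variable term; [l] records the selection, and no two terms can
    cancel. *)
Lemma support_subst_perm (V : finType) m d (a : 'I_m * 'I_m -> S)
   (b : 'I_m * 'I_m -> V -> S) :
  (forall w, nn (a w)) -> (forall w v, nn (b w v)) ->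
  deg_le (Permanent S m) d ->
  has_support (fpsubst d (Permanent S m) (fpaff a b))
   (fun M => exists (s : 'S_m) (l : 'I_m -> option V),
      (forall i, good (if l i is Some v then b (i, s i) v else a (i, s i))) /\
      M = \sum_i lab (l i)).
Proof.
move=> na nb hd.
have haff w : has_support (fpaff a b w) (fun M => exists2 o,
    good (if o is Some v then b w v else a w) & M = lab o).
  have hX v : true -> has_support (fpmul (fpC (b w v)) (fpX v))
     (fun M => good (b w v) /\ M = monX v).
    move=> _; apply: has_support_eq; last first.
      exact: support_mul (supportC (V := V) (nb w v)) (supportX v).
    move=> M.
    split=> [[_ [_ [[-> gb] -> ->]]]|[gb ->]]; first by rewrite add0r.
    by exists 0, (monX v); rewrite add0r.
  apply: has_support_eq (support_add (supportC (V := V) (na w)) (support_sum hX)) => M.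
  split=> [[[-> ga]|[v _ [gb ->]]]|[[v|] g ->]].
  - by exists None.
  - by exists (Some v).
  - by right; exists v.
  - by left.
(* The exponents 0 and 1 must fit into ['I_d.+1]. If m > 0, a monomial of degree m in the permanent
   forces m <= d by [deg_le]; if m = 0 there are no variables. *)
have mperm (s : 'S_m) w : (((\sum_(i < m) monX (i, s i))%R : mon _) w < d.+1)%N.
  rewrite perm_monE ltnS; case: (posnP m) => [m0|m_gt0].
    by case: w => i; have := ltn_ord i; rewrite {2}m0.
  rewrite (leq_trans (leq_b1 _)) // (leq_trans m_gt0) // leqNgt.
  apply/negP => dm; have [_ gM] := support_perm (\sum_(i < m) monX (i, s i)).
  have: good (Permanent S m (\sum_(i < m) monX (i, s i))).
    by apply/gM; exists s.
  rewrite hd; first exact: pos_0 pos.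
  under eq_bigr do rewrite perm_monE.
  rewrite -(pair_bigA _ (fun i j : 'I_m => nat_of_bool (j == s i))) /=.
  rewrite (leq_trans dm) // -[X in (X <= _)%N]card_ord -sum1_card leq_sum //.
  by move=> i _; rewrite (bigD1 (s i)) //= eqxx.
have hprod (D : {ffun 'I_m * 'I_m -> 'I_d.+1}) : true -> _ :=
   fun _ => support_mul (supportC (V := V) (support_perm [ffun w => nat_of_ord (D w)]).1)
     (support_prod (fun w (_ : true) => support_exp (D w) (haff w))).
apply: has_support_eq (support_sum hprod) => M; split.
  move=> [D _ [_ [_ [[-> /(support_perm _).2[s Ds]] [nu nuP ->] ->]]]].
  have {}Ds w : nat_of_ord (D w) = (w.2 == s w.1).
    by have /ffunP/(_ w) := Ds; rewrite ffunE perm_monE.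
  have /fin_all_exists[l lP] i : exists o,
      good (if o is Some v then b (i, s i) v else a (i, s i)) /\
      nu (i, s i) = lab o.
    have [mu muP ->] := nuP (i, s i) isT.
    move: mu muP; rewrite Ds eqxx => mu muP; have [o go E] := muP ord0.
    by exists o; rewrite big_ord1 E.
  exists s, l; split=> [i|]; first by have [] := lP i.
  rewrite add0r (eq_bigr (fun w => nu (w.1, w.2))) => [|[]//].
  rewrite -(pair_bigA _ (fun i j => nu (i, j))) /=; apply: eq_bigr => i _.
  rewrite (bigD1 (s i)) //= (lP i).2 big1 ?addr0 // => j neq.
  have [mu _ ->] := nuP (i, j) isT.
  by move: mu; rewrite Ds (negPf neq) => mu; rewrite big_ord0.
move=> [s [l [gl ->]]]; pose D := [ffun w => Ordinal (mperm s w)].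
exists D => //; exists 0, (\sum_i lab (l i)); split; last by rewrite add0r.
  split=> //; apply/(support_perm _).2; exists s; apply/ffunP=> w.
  by rewrite !ffunE.
exists (fun w => if w.2 == s w.1 then lab (l w.1) else 0); last first.
  rewrite -(pair_bigA _ (fun i j => if j == s i then lab (l i) else 0)) /=.
  apply: eq_bigr => i _; rewrite (bigD1 (s i)) //= eqxx big1 ?addr0 // => j neq.
  by rewrite (negPf neq).
move=> [i j] _ /=; have -> : nat_of_ord (D (i, j)) = (j == s i).
  by rewrite ffunE /= perm_monE.
case: eqP => [->|_].
  by exists (fun=> lab (l i)); [exists (l i)|rewrite big_ord1].
by exists (fun=> 0); [case|rewrite big_ord0].
Qed.

End Support.

(** * Coefficients in a totally ordered semiring *)

Section OrderedSemiring.
Variables (S : comNzSemiRingType) (le : S -> S -> Prop).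
Hypothesis hS : totally_ordered_semiring le.

Lemma tos_leM x y z t : le 0 x -> le 0 z -> le x y -> le z t -> le (x * z) (y * t).
Proof.
have [_ [_ [le_tr [_ [_ leM]]]]] := hS; move=> x0 z0 xy zt.
apply: (le_tr) (leM _ _ _ xy z0) _; rewrite ![y * _]mulrC; apply: (leM) => //.
exact: (le_tr) xy.
Qed.

Lemma tos_le0M x y : le 0 x -> le 0 y -> le 0 (x * y).
Proof.
have [_ [_ [_ [_ [_ leM]]]]] := hS; move=> x0 y0.
by rewrite -(mul0r y); apply: (leM).
Qed.

Lemma tos_leDr x y : le 0 y -> le x (x + y).
Proof.
have [_ [_ [_ [_ [leD _]]]]] := hS; move=> y0.
by rewrite -{1}(add0r x) [x + y]addrC; apply: (leD).
Qed.

(* If [1 <= 0] then [0] is the only nonnegative element, and the coefficients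
   that matter are natural numbers, which are never zero when positive. *)
Lemma positivity_natr : le 1 0 ->
  positivity (fun x : S => exists n, x = n%:R) (fun x : S => exists n, x = n.+1%:R).
Proof.
have [_ [le_as [le_tr [_ [leD _]]]]] := hS; move=> le10.
have nat_le0 n : le n%:R 0.
  elim: n => [|n IH]; first by have [] := hS.
  by rewrite -natr1; apply: (le_tr) (leD _ _ 1 IH) _; rewrite add0r.
have natS_neq0 n : n.+1%:R <> 0 :> S.
  rewrite -natr1 => n0; have /eqP := oner_neq0 S; apply; apply: (le_as) => //.
  by have := leD _ _ 1 (nat_le0 n); rewrite n0 add0r.
have gP n : (exists k, n%:R = k.+1%:R :> S) <-> (0 < n)%N.
  split=> [[k E]|]; last by case: n => // n _; exists n.
  by case: n E => // /esym/natS_neq0.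
split.
- by exists 0%N.
- by exists 1%N.
- by move=> _ _ [a ->] [b ->]; exists (a + b)%N; rewrite natrD.
- by move=> _ _ [a ->] [b ->]; exists (a * b)%N; rewrite natrM.
- by move=> [k /esym/natS_neq0].
- by exists 0%N.
- move=> _ _ [a ->] [b ->]; rewrite -natrD !gP addn_gt0.
  by split=> /orP.
- move=> _ _ [a ->] [b ->]; rewrite -natrM !gP muln_gt0.
  by split=> /andP.
Qed.

(** For 0 <= x <= y the larger term dominates a sum, (x + y)^n <= 2^n y^n, so a nilpotent y makes x
    + y nilpotent. The product controls the smaller factor, x^(2n) <= (x y)^n, so a nilpotent
    product makes x nilpotent. *)
Lemma positivity_nonnilpotent : le 0 1 ->
  positivity (le 0) (fun x => le 0 x /\ forall n, x ^+ n <> 0).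
Proof.
have [le_refl [le_as [le_tr [le_tot [leD leM]]]]] := hS; move=> le01.
have le0X x n : le 0 x -> le 0 (x ^+ n).
  by move=> x0; elim: n => [|n IH] //; rewrite exprS; apply: tos_le0M.
have leX x y n : le 0 x -> le x y -> le (x ^+ n) (y ^+ n).
  move=> x0 xy; elim: n => [|n IH] //; rewrite !exprS.
  by apply: tos_leM => //; apply: (le0X).
have le0D x y : le 0 x -> le 0 y -> le 0 (x + y).
  by move=> x0 y0; apply: (le_tr) x0 _; apply: tos_leDr.
have le0n x n : le 0 x -> le 0 (x *+ n).
  by move=> x0; elim: n => [|n IH] //; rewrite mulrS; apply: (le0D).
have up x y : le 0 x -> le x y -> (forall n, x ^+ n <> 0) ->
    forall n, y ^+ n <> 0.
  move=> x0 xy nx n yn; apply: (nx n); apply: (le_as); last exact: (le0X).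
  by rewrite -yn; apply: (leX).
split=> //.
- exact: tos_le0M.
- by case=> _ /(_ 1%N); rewrite expr1.
- by split=> // n; rewrite expr1n; apply/eqP/oner_neq0.
- move=> x y x0 y0; split; last first.
    have yxy : le y (x + y) by rewrite addrC; apply: tos_leDr.
    move=> [[_ nx]|[_ ny]]; split; try exact: (le0D).
      by apply: (up) nx => //; apply: tos_leDr.
    exact: (up) ny.
  move=> [_ nxy].
  wlog xy : x y x0 y0 nxy / le x y.
    move=> H; case: (le_tot x y) => [xy|yx]; first exact: (H).
    by apply/or_comm; apply: (H) => //; rewrite addrC.
  right; split=> // n yn; apply: (nxy n); apply: (le_as); last first.
    by apply/le0X/le0D.
  suff: le ((x + y) ^+ n) ((y *+ 2) ^+ n).
    by rewrite exprMn_n yn mul0rn.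
  by apply: (leX); [exact: (le0D)|rewrite mulr2n; apply: (leD)].
- move=> x y x0 y0; split.
    move=> [_ nxy]; split; split=> // n xn; apply: (nxy n).
      by rewrite exprMn xn mul0r.
    by rewrite exprMn xn mulr0.
  move=> [[_ nx] [_ ny]]; split; first exact: tos_le0M.
  wlog xy : x y x0 y0 nx ny / le x y.
    move=> H; case: (le_tot x y) => [xy|yx]; first exact: (H).
    by rewrite mulrC; apply: (H).
  move=> n xyn; apply: (nx (n + n)%N); apply: (le_as); last exact: (le0X).
  rewrite -xyn exprD exprMn; apply: tos_leM => //; try exact: (le0X).
  exact: (leX).
Qed.

Lemma exists_positivity : exists nn good : S -> Prop,
  positivity nn good /\ forall x, le 0 x -> nn x.
Proof.
have [_ [le_as [_ [le_tot [_ leM]]]]] := hS.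
case: (le_tot 0 1) => [le01|le10].
  by do 2 eexists; split; [exact: positivity_nonnilpotent|].
do 2 eexists; split; first exact: positivity_natr.
(* Here x = 1 x <= 0 x = 0. *)
move=> x x0; exists 0%N; apply: (le_as) => //.
by have := leM _ _ _ le10 x0; rewrite mul1r mul0r.
Qed.

(** From here on the semiring is gone: [E i j o] records which coefficients of the entry (i, j) are
    good. Goodness need not be decidable, so this finite table is obtained classically. *)
Lemma proj_perm_matchings (V : finType) (f : fpoly S V) (A : mon V -> Prop) m :
  (forall nn good, positivity nn good -> has_support nn good f A) ->
  mono_aff_proj le f (Permanent S m) ->
  exists E : 'I_m -> 'I_m -> option V -> bool, forall M, A M <->
    exists (s : 'S_m) (l : 'I_m -> option V),
      (forall i, E i (s i) (l i)) /\ M = \sum_i lab (l i).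
Proof.
move=> hA [d [hd [a [b [a0 [b0 fE]]]]]].
have [nn [good [pos le_nn]]] := exists_positivity.
pose T := ('I_m * 'I_m * option V)%type.
have /fin_all_exists[e eP] (t : T) : exists e : bool,
    e <-> good (if t.2 is Some v then b t.1 v else a t.1).
  case: (classic (good (if t.2 is Some v then b t.1 v else a t.1))) => g.
    by exists true.
  by exists false.
exists (fun i j o => e (i, j, o)) => M.
have [_ <-] := hA _ _ pos M.
have [_ gM] := support_subst_perm pos (fun w => le_nn _ (a0 w))
  (fun w v => le_nn _ (b0 w v)) hd M.
rewrite fE gM; split=> -[s [l [h ->]]]; exists s, l; split=> // i.
  by apply/eP; apply: h.
by have /eP := h i.
Qed.

End OrderedSemiring.

(** * Alternating cycles of perfect matchings *)

Section Matchings.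
Variables (V : finType) (m : nat) (E : 'I_m -> 'I_m -> option V -> bool).
Variables (s0 : 'S_m) (l0 : 'I_m -> option V).
Hypothesis El0 : forall x, E x (s0 x) (l0 x).


(* Rows are the vertices: the arc [(x, o)] leads from row [x] to the row that the
   reference matching [s0] joins to the column of an [o]-labelled edge at [x]. *)
Definition next_arc (p q : 'I_m * option V) := E p.1 (s0 q.1) p.2.

Lemma rotate_closed (T : eqType) (e : rel T) (a : T) s1 s2 :
  path.cycle e (s1 ++ a :: s2) = path.cycle e (a :: s2 ++ s1).
Proof. by rewrite -(rot_cycle (size s1)) rot_size_cat. Qed.

Lemma split_repeat (s : seq ('I_m * option V)) : ~~ uniq (map fst s) ->
  exists s1 p s2 q s3, s = s1 ++ p :: s2 ++ q :: s3 /\ p.1 = q.1.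
Proof.
elim: s => //= p s IH; rewrite negb_and negbK => /orP[|/IH].
  move=> /mapP[q qs pq]; case/splitPr: qs => s2 s3.
  by exists [::], p, s2, q, s3.
by move=> [s1 [p' [s2 [q [s3 [-> pq]]]]]]; exists (p :: s1), p', s2, q, s3.
Qed.

(** Cut between two visits to the same row. An arc depends on its target only through the row, so
    both pieces close up. *)
Lemma split_closed s : path.cycle next_arc s -> ~~ uniq (map fst s) ->
  exists s1 s2, [/\ path.cycle next_arc s1, path.cycle next_arc s2, (size s1 < size s)%N,
    (size s2 < size s)%N & perm_eq s (s1 ++ s2)].
Proof.
move=> cs /split_repeat[s1 [p [s2 [q [s3 [Es pq]]]]]].
subst s; move: cs; rewrite rotate_closed -catA cat_cons /= rcons_cat cat_path /=.
move=> /and3P[p1 e1 p2].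
exists (p :: s2), (q :: s3 ++ s1); split.
- by rewrite /= rcons_path p1 /= /next_arc pq.
- by move: p2; rewrite /= !rcons_path /next_arc pq.
- by rewrite !size_cat /= !size_cat /=; lia.
- by rewrite !size_cat /= !size_cat /=; lia.
- by rewrite perm_catC /= -!catA.
Qed.

(** Reroute the rows on the walk along it and keep the reference edges elsewhere. [G] takes values
    in any commutative monoid, so that one identity serves for weights in [int] and exponents in
    [nat]. *)
Lemma simple_closed s : path.cycle next_arc s -> uniq (map fst s) ->
  exists (t : 'S_m) (l : 'I_m -> option V), (forall x, E x (t x) (l x)) /\
    forall (R : nmodType) (G : 'I_m -> option V -> R),
    \sum_x G x (l x) =
      \sum_(p <- s) G p.1 p.2 + \sum_(x | x \notin map fst s) G x (l0 x).
Proof.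
move=> cs us; set r := map fst s in us *.
have inj_next : injective (next r) by apply: can_inj (prev_next us).
pose l x := if x \in r then (nth (x, None) s (index x r)).2 else l0 x.
have lE p : p \in s -> l p.1 = p.2.
  move=> ps; rewrite /l map_f //.
  have i_lt : (index p s < size s)%N by rewrite index_mem.
  suff -> : index p.1 r = index p s by rewrite nth_index.
  have -> : p.1 = nth p.1 r (index p s) by rewrite (nth_map p) // nth_index.
  by rewrite index_uniq // size_map.
(* The left factor of a product of permutations acts first: a row goes to the [s0]-column of the
   next row, as [next_arc] demands. *)
exists (perm inj_next * s0)%g, l; split=> [x|R G].
  rewrite permM permE /l; case: ifP => [xr|/negbT xr]; last first.
    by rewrite next_nth (negPf xr).
  rewrite next_nth xr.
  have i_lt : (index x r < size s)%N by rewrite -(size_map fst) index_mem.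
  have {inj_next l lE}xE : nth x r (index x r) = x by rewrite nth_index.
  clear xr; rewrite {}/r in us i_lt xE *; set i := index x _ in i_lt xE *.
  case: s cs us @i i_lt xE => // p s cs us i i_lt xE.
  have /(pathP p)/(_ i) := cs; rewrite size_rcons => /(_ i_lt).
  rewrite /next_arc; congr (E _ _ _).
  - by rewrite -rcons_cons nth_rcons i_lt -[RHS]xE (nth_map p).
  - congr (s0 _); rewrite nth_rcons /=.
    have [lt|ge] := ltnP i (size s); first by rewrite (nth_map p).
    by rewrite [RHS]nth_default ?size_map //; case: eqP.
  - by rewrite -rcons_cons nth_rcons i_lt; congr _.2; exact: set_nth_default.
rewrite (bigID (mem r)) /=; congr (_ + _); last first.
  by apply: eq_bigr => x /negPf xr; rewrite /l xr.
rewrite -big_uniq //= big_map; apply: eq_big_seq => p ps.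
by rewrite lE.
Qed.
End Matchings.

(** * Closed walks and tight faces of the Newton polytope *)

Definition wt (V : finType) (w : V -> int) (M : mon V) : int :=
  \sum_v w v *+ M v.

Lemma wt_sum (V I : finType) (w : V -> int) (mu : I -> mon V) :
  wt w (\sum_i mu i) = \sum_i wt w (mu i).
Proof.
rewrite /wt exchange_big /=; apply: eq_bigr => v _.
by rewrite mon_sumE -sumrMnr.
Qed.

Section Pyramid.
Variables (V : finType) (m : nat) (E : 'I_m -> 'I_m -> option V -> bool).
Variable F : mon V -> Prop.
Hypothesis FE : forall (s : 'S_m) (l : 'I_m -> option V),
  (forall i, E i (s i) (l i)) -> F (\sum_i lab (l i)).
Variables (w : V -> int) (beta : int) (z : V).
Hypothesis wt_max : forall M, F M -> wt w M <= beta.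
Variables (k Q : nat) (rho : 'I_k * 'I_k -> V).
Hypothesis Q_gt0 : (0 < Q)%N.
Hypothesis face : forall M, F M -> wt w M = beta ->
  (forall p, M (rho p) = 0%N) \/
  M z = 0%N /\ exists pi : 'S_k, forall p, M (rho p) = ((p.2 == pi p.1) * Q)%N.

Variables (s0 : 'S_m) (l0 : 'I_m -> option V) (i0 : 'I_m).
Hypothesis El0 : forall x, E x (s0 x) (l0 x).
Hypothesis wt_l0 : \sum_i wt w (lab (l0 i)) = beta.
Hypothesis l0_i0 : l0 i0 = Some z.

Let closed (s : seq ('I_m * option V)) := path.cycle (next_arc E s0) s.
(** Change of weight when the arcs of [s] replace the reference edges of their rows; a row visited
    repeatedly counts each time. *)
Definition gain (s : seq ('I_m * option V)) : int :=
  \sum_(p <- s) (wt w (lab p.2) - wt w (lab (l0 p.1))).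
Definition occ (v : V) (s : seq ('I_m * option V)) : nat :=
  \sum_(p <- s) lab p.2 v.

Lemma gain_cat s t : gain (s ++ t) = gain s + gain t.
Proof. exact: big_cat. Qed.
Lemma occ_cat v s t : occ v (s ++ t) = (occ v s + occ v t)%N.
Proof. exact: big_cat. Qed.
Lemma gain_perm s t : perm_eq s t -> gain s = gain t.
Proof. exact: perm_big. Qed.
Lemma occ_perm v s t : perm_eq s t -> occ v s = occ v t.
Proof. exact: perm_big. Qed.

Lemma face_z M : F M -> wt w M = beta -> (0 < M z)%N -> forall p, M (rho p) = 0%N.
Proof. by move=> FM wM; case: (face FM wM) => // -[->]. Qed.

(** The reference monomial is tight and contains [z], so [face] leaves it no [rho] label; exponents
    being natural numbers, no single edge has one. *)
Lemma l0_rho x p : lab (l0 x) (rho p) = 0%N.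
Proof.
have FM := FE El0; have wM := wt_sum w (fun i => lab (l0 i)).
rewrite wt_l0 in wM; have := face_z FM wM.
rewrite mon_sumE (bigD1 i0) //= l0_i0 monXE eqxx => /(_ isT p).
by rewrite mon_sumE => /eqP; rewrite sum_nat_eq0 => /forallP/(_ x)/eqP.
Qed.

(** The exponents of [rho] come from the walk alone by [l0_rho]. Off the walk the reference labels
    stay, among them [z] if row [i0] is missed. *)
Lemma simple_closed_mono s : closed s -> uniq (map fst s) ->
  exists M, [/\ F M, wt w M = beta + gain s,
    forall p, M (rho p) = occ (rho p) s &
    i0 \notin map fst s -> (0 < M z)%N].
Proof.
move=> cs us; have [t [l [El sumE]]] := simple_closed El0 cs us.
exists (\sum_i lab (l i)); split.
- exact: FE El.
- rewrite wt_sum (sumE _ (fun _ o => wt w (lab o))) -wt_l0 /gain sumrB.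
  rewrite (bigID (mem (map fst s)) predT) /= -[X in _ = X + _ + _]big_uniq //=.
  by rewrite big_map [RHS]addrC [RHS]addrA subrK.
- move=> p; rewrite mon_sumE (sumE nat (fun _ o => lab o (rho p))).
  rewrite /occ [X in _ + X](@big1 nat) ?addr0 // => x _; exact: l0_rho.
- move=> i0s; rewrite mon_sumE (sumE nat (fun _ o => lab o z)).
  by rewrite [X in _ + X](bigD1 i0) //= l0_i0 monXE eqxx addn_gt0 orbT.
Qed.

(** Split at repeated rows until the walk is simple; a simple closed walk of positive gain would
    give a monomial heavier than [beta]. *)
Lemma closed_gain s : closed s -> gain s <= 0.
Proof.
have [n] := ubnP (size s); elim: n s => // n IH s lt_s cs.
case: (boolP (uniq (map fst s))) => [us|nus].
  have [M [FM wM _ _]] := simple_closed_mono cs us.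
  by have := wt_max FM; rewrite wM gerDl.
have [s1 [s2 [c1 c2 lt1 lt2 Es]]] := split_closed cs nus.
rewrite (gain_perm Es) gain_cat; have := IH s1 _ c1; have := IH s2 _ c2.
lia.
Qed.

Lemma split_closed_tight s s1 s2 : closed s1 -> closed s2 -> gain s = 0 ->
  perm_eq s (s1 ++ s2) -> gain s1 = 0 /\ gain s2 = 0.
Proof.
move=> c1 c2 g0 Es; have g1 := closed_gain c1; have g2 := closed_gain c2.
by move: g0; rewrite (gain_perm Es) gain_cat => ?; lia.
Qed.

(** Every simple piece is itself tight and misses [i0], so its monomial keeps [z] and the face
    leaves it no [rho] label. *)
Lemma closed_off s : closed s -> gain s = 0 -> i0 \notin map fst s ->
  forall p, occ (rho p) s = 0%N.
Proof.
have [n] := ubnP (size s); elim: n s => // n IH s lt_s cs g0 i0s p.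
case: (boolP (uniq (map fst s))) => [us|nus].
  have [M [FM wM Mrho /(_ i0s) Mz]] := simple_closed_mono cs us.
  by rewrite -Mrho face_z // wM g0 addr0.
have [s1 [s2 [c1 c2 lt1 lt2 Es]]] := split_closed cs nus.
have [g1 g2] := split_closed_tight c1 c2 g0 Es.
have := i0s; rewrite (perm_mem (perm_map fst Es)) map_cat mem_cat negb_or.
by case/andP=> ? ?; rewrite (occ_perm _ Es) occ_cat !IH //; lia.
Qed.

(** Exactly one piece of a splitting passes through [i0]; the other carries no [rho] label and is
    dropped, until a simple closed walk remains. *)
Lemma closed_on s : closed s -> gain s = 0 -> count_mem i0 (map fst s) = 1%N ->
  exists M, [/\ F M, wt w M = beta & forall p, M (rho p) = occ (rho p) s].
Proof.
have [n] := ubnP (size s); elim: n s => // n IH s lt_s cs g0 i0s.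
case: (boolP (uniq (map fst s))) => [us|nus].
  have [M [FM wM Mrho _]] := simple_closed_mono cs us.
  by exists M; rewrite wM g0 addr0.
have [s1 [s2 [c1 c2 lt1 lt2 Es]]] := split_closed cs nus.
have [g1 g2] := split_closed_tight c1 c2 g0 Es.
have := i0s; rewrite (seq.permP (perm_map fst Es)) map_cat count_cat.
case E1: (count_mem i0 (map fst s1)) => [|[|//]] /=; last first.
  move=> /succn_inj/count_memPn i2.
  have [|M [FM wM Mrho]] := IH s1 _ c1 g1 E1; first by lia.
  exists M; split=> // p.
  by rewrite (occ_perm _ Es) occ_cat (closed_off c2 g2 i2) addn0.
rewrite add0n => E2; have /count_memPn i1 := E1.
have [|M [FM wM Mrho]] := IH s2 _ c2 g2 E2; first by lia.
exists M; split=> // p.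
by rewrite (occ_perm _ Es) occ_cat (closed_off c1 g1 i1).
Qed.

(** The walk is the orbit of [i0] under [t], that is, the alternating cycle through [i0] in the
    union of the two matchings. *)
Lemma perm_closed (s : 'S_m) (l : 'I_m -> option V) :
  (forall x, E x (s x) (l x)) -> \sum_x wt w (lab (l x)) = beta ->
  exists r o, let c := (i0, o) :: r in
  [/\ closed c, gain c = 0, uniq (map fst c) &
   forall p, occ (rho p) c = (\sum_x lab (l x) (rho p))%N].
Proof.
move=> El wl; pose t x := (s0^-1)%g (s x).
have s0t x : s0 (t x) = s x by rewrite /t permKV.
have inj_t : injective t by move=> x y /perm_inj/perm_inj.
pose c := [seq (x, l x) | x <- fingraph.orbit t i0].
have mc : map fst c = fingraph.orbit t i0 by rewrite -map_comp map_id.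
have Gc (R : nmodType) (G : 'I_m -> option V -> R) :
    \sum_(p <- c) G p.1 p.2 = \sum_(x | x \in fingraph.orbit t i0) G x (l x).
  by rewrite big_map -big_uniq //; apply: orbit_uniq.
have [r [o Ec]] : exists r o, c = (i0, o) :: r.
  rewrite /c /fingraph.orbit -orderSpred /=; by do 2 eexists.
exists r, o => c0; rewrite {}/c0 -Ec.
have cc : closed c.
  rewrite /closed /c cycle_map; apply: sub_cycle (cycle_orbit inj_t i0) => x y.
  by rewrite /next_arc /= => /eqP <-; rewrite s0t.
have uc : uniq (map fst c) by rewrite mc orbit_uniq.
have gain_le := closed_gain cc.
(* The complementary exchange: reference edges on the orbit, [s] elsewhere. Its weight
   [beta - gain c] forces [gain c = 0], and as it retains [z] at [i0] it has no [rho] label, so none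
   occurs off the orbit. *)
pose l' x := if x \in fingraph.orbit t i0 then l0 x else l x.
have inO x : (t x \in fingraph.orbit t i0) = (x \in fingraph.orbit t i0).
  by rewrite -!fconnect_orbit -same_fconnect1_r.
have inj' : injective (fun x => if x \in fingraph.orbit t i0 then s0 x else s x).
  move=> x y; case: ifP => Ox; case: ifP => Oy; try exact: perm_inj.
    rewrite -s0t => /perm_inj xy; by rewrite xy inO Oy in Ox.
  rewrite -s0t => /perm_inj xy; by rewrite -xy inO Ox in Oy.
have El' x : E x (perm inj' x) (l' x) by rewrite permE /l'; case: ifP.
have FM := FE El'; have wM := wt_sum w (fun i => lab (l' i)).
have split0 (R : nmodType) (G : 'I_m -> option V -> R) : \sum_x G x (l' x) =
    \sum_(x | x \in fingraph.orbit t i0) G x (l0 x) +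
    \sum_(x | x \notin fingraph.orbit t i0) G x (l x).
  rewrite (bigID (mem (fingraph.orbit t i0))) /=; congr (_ + _); apply: eq_bigr => x.
    by rewrite /l' => ->.
  by rewrite /l' => /negPf ->.
have gE : wt w (\sum_i lab (l' i)) = beta - gain c.
  rewrite wM (split0 _ (fun _ o => wt w (lab o))) -wl.
  rewrite /gain (Gc _ (fun x o => wt w (lab o) - wt w (lab (l0 x)))) sumrB.
  rewrite [in RHS](bigID (mem (fingraph.orbit t i0))) /= opprB.
  by rewrite [RHS]addrC [RHS]addrA subrK.
have g0 : gain c = 0.
  by apply/eqP; rewrite eq_le gain_le /=; have := wt_max FM; rewrite gE; lia.
split=> // p; rewrite /occ (Gc nat (fun _ o => lab o (rho p))).
rewrite [RHS](bigID (mem (fingraph.orbit t i0))) /= [X in _ = _ + X]big1 ?addr0 //.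
have Mz : (0 < ((\sum_i lab (l' i))%R : mon V) z)%N.
  by rewrite mon_sumE (bigD1 i0) //= /l' -fconnect_orbit connect0 l0_i0 monXE eqxx.
have := face_z FM _ Mz p; rewrite gE g0 subr0 => /(_ erefl).
rewrite mon_sumE (split0 nat (fun _ o => lab o (rho p))) => /eqP.
rewrite addn_eq0 => /andP[_]; rewrite sum_nat_eq0 => /forall_inP H x Ox.
exact/eqP/H.
Qed.

Hypothesis rho_inj : injective rho.

Definition started (P : seq ('I_m * option V)) : {set 'I_k} :=
  [set i | [exists j, (0 < occ (rho (i, j)) P)%N]].

(** One arc carries at most one label and [rho] is injective, so the count of rows grows by at most
    one per arc, and [cut_started] can stop at any intermediate value. *)
Lemma started_rcons P a : (#|started (rcons P a)| <= #|started P|.+1)%N.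
Proof.
have occ1 p : occ (rho p) (rcons P a) = (occ (rho p) P + lab a.2 (rho p))%N.
  by rewrite -cats1 occ_cat /occ big_seq1.
case: (pickP (fun p => (0 < lab a.2 (rho p))%N)) => [[i j] ij|none]; last first.
  rewrite (_ : started _ = started P) //.
  apply/setP=> i; rewrite !inE; apply: eq_existsb => j.
  by rewrite occ1 addn_gt0 none orbF.
have : started (rcons P a) \subset i |: started P.
  apply/subsetP=> i'; rewrite !inE => /existsP[j'].
  rewrite occ1 addn_gt0 => /orP[h|h].
    by apply/orP; right; apply/existsP; exists j'.
  apply/orP; left; move: ij h; case: a.2 => [v|]; rewrite /= ?ffunE //.
  rewrite !lt0b => /eqP ij /eqP; rewrite -ij => /rho_inj[-> _].
  exact: eqxx.
move/subset_leq_card/leq_trans; apply; rewrite cardsU1.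
by case: (i \notin _) => //; rewrite ltnW.
Qed.

Lemma cut_started c j : (j <= #|started c|)%N ->
  exists P R, c = P ++ R /\ #|started P| = j.
Proof.
have none0 : started [::] = set0.
  by apply/setP=> i; rewrite !inE; apply/existsP=> -[j0]; rewrite /occ big_nil.
elim/last_ind: c => [|c a IH].
  rewrite (_ : started [::] = set0) ?cards0 ?leqn0.
    by move=> /eqP->; exists [::], [::]; rewrite none0 cards0.
  exact: none0.
rewrite leq_eqVlt => /orP[/eqP ->|lt]; first by exists (rcons c a), [::]; rewrite cats0.
have [|P [R [-> Pj]]] := IH; first by have := started_rcons c a; lia.
by exists P, (rcons R a); rewrite rcons_cat.
Qed.

(* [c = P ++ R] is the walk of a matching for [pi], cut at row [v] when [j] rows
   of the permutation matrix have been met. *)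
Definition cut_at (j : nat) (pi : 'S_k) (v : 'I_m) (P R : seq ('I_m * option V)) :=
  exists o P' a R', let c := P ++ R in
  [/\ P = (i0, o) :: P', R = (v, a) :: R', closed c & gain c = 0] /\
  [/\ uniq (map fst c), #|started P| = j &
   forall p, occ (rho p) c = ((p.2 == pi p.1) * Q)%N].

Lemma exists_cut j (pi : 'S_k) (s : 'S_m) (l : 'I_m -> option V) :
  (0 < j < k)%N -> (forall x, E x (s x) (l x)) ->
  \sum_x wt w (lab (l x)) = beta ->
  (forall i, (0 < \sum_x lab (l x) (rho (i, pi i)))%N) ->
  exists v P R, cut_at j pi v P R.
Proof.
move=> /andP[j0 jk] El wl pos.
have [r [o [cc gc uc occE]]] := perm_closed El wl; set c := _ :: r in cc gc uc occE.
have occ_pi p : occ (rho p) c = ((p.2 == pi p.1) * Q)%N.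
  have FM := FE El; have wM := wt_sum w (fun i => lab (l i)); rewrite wl in wM.
  rewrite occE -mon_sumE; case: (face FM wM) => [M0|[_ [pi' M1]]].
    by have := pos (Ordinal jk); rewrite -mon_sumE M0.
  rewrite M1; suff -> : pi = pi' by [].
  apply/permP=> i; have := pos i; rewrite -mon_sumE M1 /=.
  by case: eqP.
have sc : started c = setT.
  apply/setP=> i; rewrite !inE; apply/existsP; exists (pi i).
  by rewrite occ_pi eqxx mul1n.
have [|P [R [Ec Pj]]] := @cut_started c j.
  by rewrite sc cardsT card_ord ltnW.
(* Since 0 < j the first piece is nonempty, and since j < k so is the second: they begin at [i0] and
   at the cut row [v]. *)
case: P Pj Ec => [|p P'] Pj Ec.
  move: j0; rewrite -Pj card_gt0 => /set0Pn[i]; rewrite inE => /existsP[?].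
  by rewrite /occ big_nil.
case: R Ec => [|[v a] R'] Ec.
  by move: jk; rewrite -Pj -[_ :: _]cats0 -Ec sc cardsT card_ord ltnn.
exists v, (p :: P'), ((v, a) :: R'), o, P', a, R'; rewrite -Ec; split; split=> //.
by case: Ec => <-.
Qed.

(** The junction depends only on the row [v] and the closing arc only on the row [i0], both shared
    by the two walks. *)
Lemma cut_glue_closed j pi1 pi2 v P1 R1 P2 R2 :
  cut_at j pi1 v P1 R1 -> cut_at j pi2 v P2 R2 -> closed (P1 ++ R2).
Proof.
move=> [o1 [P1' [a1 [R1' [[-> -> c1 _] _]]]]] [o2 [P2' [a2 [R2' [[-> -> c2 _] _]]]]].
move: c1 c2; rewrite /closed /= !rcons_cat !cat_path /= !rcons_path.
by move=> /and3P[-> e1 _] /and3P[_ _ ->]; rewrite andbT.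
Qed.

(** The glued walk [P1 ++ R2] yields a permutation [kap] that agrees with [pi1] on the started rows
    and with [pi2] on the others. As [kap] is a bijection, [pi1] and [pi2] then have the same image
    of the started rows. *)
Lemma cut_glue j pi1 pi2 v P1 R1 P2 R2 : (0 < j)%N ->
  cut_at j pi1 v P1 R1 -> cut_at j pi2 v P2 R2 ->
  started P1 = started P2 /\ pi1 @: started P1 = pi2 @: started P1.
Proof.
move=> j0 cut1 cut2.
have c12 := cut_glue_closed cut1 cut2; have c21 := cut_glue_closed cut2 cut1.
have g12 := closed_gain c12; have g21 := closed_gain c21.
move: cut1 cut2 => [o1 [P1' [a1 [R1' [[E1 F1 _ g1] [u1 s1 oc1]]]]]].
move=> [o2 [P2' [a2 [R2' [[E2 F2 _ g2] [u2 s2 oc2]]]]]].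
(* The two crossed gains are nonpositive and add up to the two original gains, which vanish. *)
have {g21}g12 : gain (P1 ++ R2) = 0.
  by move: g1 g2 g12 g21; rewrite !gain_cat; lia.
have i12 : count_mem i0 (map fst (P1 ++ R2)) = 1%N.
  move: u1 u2; rewrite E1 E2 !map_cat /= count_cat eqxx => /andP[i1 _] /andP[i2 _].
  move: i1 i2; rewrite !mem_cat !negb_or => /andP[/count_memPn -> _].
  by case/andP=> _ /count_memPn ->.
have [M [FM wM Mrho]] := closed_on c12 g12 i12.
have occ_le1 p : (occ (rho p) P1 <= occ (rho p) (P1 ++ R2))%N.
  by rewrite occ_cat leq_addr.
(* The first case is impossible: j > 0 puts some [rho] label on [P1]. *)
case: (face FM wM) => [M0|[_ [kap Mk]]].
  have: (0 < #|started P1|)%N by rewrite s1.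
  rewrite card_gt0 => /set0Pn[i]; rewrite inE => /existsP[l].
  by have := occ_le1 (i, l); rewrite -Mrho M0 leqn0 => /eqP ->.
have occE p : (occ (rho p) P1 + occ (rho p) R2 = (p.2 == kap p.1) * Q)%N.
  by rewrite -occ_cat -Mrho Mk.
have row (f : 'I_k -> nat) i (sig : 'S_k) :
    (forall l, f l = (l == sig i) * Q)%N -> (\sum_l f l)%N = Q.
  move=> fE; rewrite (bigD1 (sig i)) //= fE eqxx mul1n big1 ?addn0 // => l ne.
  by rewrite fE (negPf ne).
(* In each row both [P1] and [P2] complete [R2] to the total [Q]. *)
have rowP i : (\sum_l occ (rho (i, l)) P1 = \sum_l occ (rho (i, l)) P2)%N.
  have := row (fun l => occ (rho (i, l)) P1 + occ (rho (i, l)) R2)%N i kap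
    (fun l => occE (i, l)).
  have := row (fun l => occ (rho (i, l)) P2 + occ (rho (i, l)) R2)%N i pi2.
  rewrite !big_split /= => <-; last by move=> l; rewrite -occ_cat oc2.
  by move/eqP; rewrite eqn_add2r => /eqP.
have startedE P i : (i \in started P) = (0 < \sum_l occ (rho (i, l)) P)%N.
  rewrite inE lt0n sum_nat_eq0 negb_forall.
  by apply: eq_existsb => l; rewrite lt0n.
have S12 : started P1 = started P2.
  by apply/setP=> i; rewrite !startedE rowP.
split=> //.
have in1 i : i \in started P1 -> kap i = pi1 i.
  rewrite inE => /existsP[l l_gt0].
  have := oc1 (i, l); have := occE (i, l); rewrite occ_cat /=.
  case: eqP => [<- _|_ /eqP]; last by rewrite mul0n addn_eq0 -leqn0 leqNgt l_gt0.
  by case: eqP => [<-|_ /eqP] //; rewrite mul0n addn_eq0 -leqn0 leqNgt l_gt0.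
have in2 i : i \notin started P1 -> kap i = pi2 i.
  move=> iS; have P0 P : started P = started P1 -> occ (rho (i, pi2 i)) P = 0%N.
    move=> SP; move: iS; rewrite -SP startedE -leqNgt leqn0 sum_nat_eq0.
    by move=> /forallP/(_ (pi2 i))/eqP.
  have := oc2 (i, pi2 i); have := occE (i, pi2 i); rewrite occ_cat (P0 P1) // (P0 P2) //=.
  rewrite !add0n eqxx => ->; case: eqP => [<-|_] //.
  by rewrite mul1n mul0n => Q0; have := Q_gt0; rewrite -Q0.
have -> : pi1 @: started P1 = kap @: started P1.
  by apply: eq_in_imset => i /in1.
apply/setP=> x; rewrite -[x](permKV kap) mem_imset; last exact: perm_inj.
set y := (kap^-1)%g x; case: (boolP (y \in _)) => yS; last first.
  by rewrite in2 // mem_imset ?(negPf yS) //; apply: perm_inj.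
rewrite -[kap y](permKV pi2) mem_imset; last exact: perm_inj.
apply/esym/negPn/negP => y'S; have := in2 _ y'S.
by rewrite permKV => /perm_inj E'; rewrite E' yS in y'S.
Qed.

End Pyramid.

(** * Counting permutations by the image of a set *)

Lemma perm_imset_transitive (T : finType) (A B : {set T}) : #|A| = #|B| ->
  exists g : {perm T}, g @: A = B.
Proof.
have [n] := ubnP #|A :\: B|; elim: n A => // n IH A ltn AB.
case: (set_0Vmem (A :\: B)) => [D0|[x xAB]].
  have sAB : A \subset B by rewrite -setD_eq0 D0.
  exists 1%g; apply/eqP; rewrite (eq_imset _ (@perm1 T)) imset_id.
  by rewrite eqEcard sAB AB leqnn.
have : (0 < #|B :\: A|)%N.
  have := cardsID B A; have := cardsID A B; rewrite setIC.
  have : (0 < #|A :\: B|)%N by rewrite card_gt0; apply/set0Pn; exists x.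
  lia.
rewrite card_gt0 => /set0Pn[y yBA].
move: (xAB) (yBA); rewrite !inE => /andP[xB xA] /andP[yA yB].
(* Exchanging x in A minus B with y in B minus A shrinks the difference. *)
have [|//|g <-] := IH (tperm x y @: A).
- apply: leq_trans (_ : #|A :\: B| <= n)%N; last by rewrite -ltnS.
  apply: proper_card; apply/properP; split; last first.
    exists x => //; rewrite !inE xB /=; apply/imsetP=> -[a aA].
    case: tpermP => [_ xy|ay _|nax _ /esym //].
      by rewrite xy yB in xB.
    by rewrite -ay aA in yA.
  apply/subsetP=> _ /setDP[/imsetP[a aA ->] aB]; rewrite inE aB /=.
  by move: aB; case: tpermP => [_|ay _|//]; [rewrite yB|rewrite -ay aA in yA].
- by rewrite card_imset //; apply: perm_inj.
exists (tperm x y * g)%g; rewrite -imset_comp; apply: eq_imset => a.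
by rewrite permM.
Qed.

(** Permutations are classified by the image of [A]. Right translation by a [g] moving [B] to [C]
    embeds one class into another, and there are ['C(k, #|A|)] classes. *)
Lemma card_perm_imset k (A B : {set 'I_k}) :
  (#|[set pi : 'S_k | pi @: A == B]| * 'C(k, #|A|) <= k`!)%N.
Proof.
case: (eqVneq #|A| #|B|) => [AB|nAB]; last first.
  rewrite (_ : [set pi : 'S_k | _] = set0) ?cards0 //.
  apply/setP=> pi; rewrite !inE; apply: contraNF nAB => /eqP <-.
  by rewrite card_imset //; apply: perm_inj.
have -> : (k`! = \sum_(C : {set 'I_k} | #|C| == #|A|)
    #|[set pi : 'S_k | pi @: A == C]|)%N.
  rewrite -{1}(card_Sn k) -[LHS]sum1_card.
  rewrite (partition_big (fun pi : 'S_k => pi @: A) (fun C => #|C| == #|A|)) /=.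
    by apply: eq_bigr => C _; rewrite -sum1_card; apply: eq_bigl => pi; rewrite inE.
  by move=> pi _; rewrite card_imset //; apply: perm_inj.
rewrite -[X in 'C(X, _)](card_ord k) -card_draws mulnC -sum_nat_const.
rewrite [X in (_ <= X)%N](eq_bigl (mem [set C : {set 'I_k} | #|C| == #|A|])).
  apply: leq_sum => C; rewrite inE AB => /eqP/esym/perm_imset_transitive[g gBC].
  rewrite -(card_imset _ (mulIg g)); apply/subset_leq_card/subsetP.
  move=> x /imsetP[pi]; rewrite inE => /eqP piAB ->{x}; rewrite inE.
  rewrite -gBC -piAB -imset_comp; apply/eqP/eq_imset => a; exact: permM.
by move=> C; rewrite [RHS]inE.
Qed.

(** Choose one cut row for each permutation. By [cut_glue] a fibre of this choice sends one j-set to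
    one fixed j-set, so it holds at most k! / ['C(k, j)] permutations, and m fibres must exhaust all
    k!. *)
Lemma perm_size_bound (V : finType) (m : nat)
    (E : 'I_m -> 'I_m -> option V -> bool) (F : mon V -> Prop)
    (w : V -> int) (beta : int) (z : V) (k Q j : nat) (rho : 'I_k * 'I_k -> V) :
  (forall M, F M <-> exists (s : 'S_m) (l : 'I_m -> option V),
      (forall i, E i (s i) (l i)) /\ M = \sum_i lab (l i)) ->
  (forall M, F M -> wt w M <= beta) ->
  (0 < Q)%N -> injective rho ->
  (forall M, F M -> wt w M = beta ->
    (forall p, M (rho p) = 0%N) \/
    M z = 0%N /\ exists pi : 'S_k, forall p, M (rho p) = ((p.2 == pi p.1) * Q)%N) ->
  (exists M, [/\ F M, wt w M = beta & 0 < M z]%N) ->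
  (forall pi : 'S_k, exists M,
    [/\ F M, wt w M = beta & forall i, 0 < M (rho (i, pi i))]%N) ->
  (0 < j < k)%N -> ('C(k, j) <= m)%N.
Proof.
move=> FE wmax Q0 inj_rho face [M0 [FM0 wM0 M0z]] perms jk.
have FE' (s : 'S_m) (l : 'I_m -> option V) :
    (forall i, E i (s i) (l i)) -> F (\sum_i lab (l i)).
  by move=> El; apply/FE; exists s, l.
have /FE[s0 [l0 [El0 EM0]]] := FM0.
have [i0 l0i0] : exists i0, l0 i0 = Some z.
  move: M0z; rewrite EM0 mon_sumE lt0n sum_nat_eq0 negb_forall => /existsP[i].
  rewrite /=; case El: (l0 i) => [v|]; rewrite /= ?ffunE //.
  by rewrite eqb0 negbK => /eqP->; exists i.
rewrite EM0 wt_sum in wM0.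
have /fin_all_exists[cut cutP] (pi : 'S_k) :
    exists c : 'I_m * seq ('I_m * option V) * seq ('I_m * option V),
    cut_at E w Q rho s0 l0 i0 j pi c.1.1 c.1.2 c.2.
  have [M [/FE[s [l [El ->]]] wM pos]] := perms pi.
  have [v [P [R c]]] : exists v P R, cut_at E w Q rho s0 l0 i0 j pi v P R.
    apply: (exists_cut FE' wmax Q0 face El0 wM0 l0i0 inj_rho jk El).
      by rewrite -wt_sum.
    by move=> i; rewrite -mon_sumE.
  by exists (v, P, R).
have /andP[j0 _] := jk.
have fib v : (#|[set pi : 'S_k | (cut pi).1.1 == v]| * 'C(k, j) <= k`!)%N.
  case: (set_0Vmem [set pi : 'S_k | (cut pi).1.1 == v]) => [->|[pi0]].
    by rewrite cards0.
  rewrite inE => /eqP pi0v; set A := started rho (cut pi0).1.2.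
  have Aj : #|A| = j by have [? [? [? [? [_ []]]]]] := cutP pi0.
  apply: leq_trans (card_perm_imset A (pi0 @: A)); rewrite Aj leq_mul2r.
  apply/orP; right; apply: subset_leq_card; apply/subsetP=> pi.
  rewrite !inE => /eqP piv; have c0 := cutP pi0; have c1 := cutP pi.
  rewrite pi0v in c0; rewrite piv in c1.
  have [_ AE] := cut_glue FE' wmax Q0 face El0 wM0 l0i0 j0 c0 c1.
  exact/eqP/esym.
have kf : (k`! = \sum_v #|[set pi : 'S_k | (cut pi).1.1 == v]|)%N.
  rewrite -(card_Sn k) -[LHS]sum1_card.
  rewrite (partition_big (fun pi => (cut pi).1.1) predT) //=.
  by apply: eq_bigr => v _; rewrite -sum1_card; apply: eq_bigl => pi; rewrite inE.
have : (k`! * 'C(k, j) <= m * k`!)%N.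
  rewrite {1}kf big_distrl /= -[X in (_ <= X * _)%N](card_ord m) -sum_nat_const.
  exact: leq_sum.
by rewrite mulnC leq_pmul2r // fact_gt0.
Qed.

(** * The face of Sat *)

Lemma injection_ord (T : finType) n : (#|T| <= n)%N ->
  exists f : T -> 'I_n, injective f.
Proof.
move=> le_n; exists (fun x => widen_ord le_n (enum_rank x)) => x y /(congr1 val) /= E.
exact/enum_rank_inj/val_inj.
Qed.

Lemma sum_at_most_one (T : finType) (b : pred T) :
  (forall x y, b x -> b y -> x = y) -> (\sum_x b x <= 1)%N.
Proof.
move=> b1; case: (pickP b) => [x bx|b0]; last by rewrite big1 // => x _; rewrite b0.
rewrite (bigD1 x) //= bx big1 // => y; case by_: (b y) => // /eqP[].
exact: b1.
Qed.

Lemma row_col_perm k (N : 'I_k -> 'I_k -> nat) :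
  (forall i, \sum_l N i l = 1)%N -> (forall l, \sum_i N i l <= 1)%N ->
  exists pi : 'S_k, forall i l, N i l = (l == pi i).
Proof.
move=> row col.
have /fin_all_exists[f fP] i : exists l, forall l', N i l' = (l' == l).
  case: (pickP (fun l => 0 < N i l)%N) => [l Nl|N0]; last first.
    have := row i; rewrite big1 // => l _; have := N0 l; case: (N i l) => //.
  exists l => l'; have := row i; rewrite (bigD1 l) //=.
  case: eqVneq => [->|ne]; first by case: (N i l) Nl => [|[|]].
  rewrite (bigD1 l') //=; move: Nl; case: (N i l) => // a _.
  by case: (N i l') => // b; rewrite addSn addnS.
have inj_f : injective f.
  move=> i i' fE; apply/eqP/negPn/negP => ne; have := col (f i).
  rewrite (bigD1 i) //= fP eqxx (bigD1 i') 1?eq_sym //= fP fE eqxx.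
  by rewrite addnCA.
by exists (perm inj_f) => i l; rewrite permE fP.
Qed.

Lemma wt_nat (V : finType) (w : V -> nat) (M : mon V) :
  wt (fun v => (w v)%:Z) M = (\sum_v w v * M v)%N%:Z.
Proof.
rewrite /wt (big_morph Posz PoszD (erefl _)); apply: eq_bigr => v _.
by rewrite -mulr_natr PoszM natz.
Qed.

Section Sat.
Variables (q n : nat).

Definition sat_mon (a : {ffun 'I_n -> bool}) : mon (sat_var n) :=
  [ffun v => match v with
             | inl i => a i * (q - 1)
             | inr c => satisfies a c * (q - 1)
             end]%N.

Lemma support_Sat (S : comNzSemiRingType) (nn good : S -> Prop) :
  positivity nn good ->
  has_support nn good (Sat S q n) (fun M => exists a, M = sat_mon a).
Proof.
move=> pos.
have hX (v : sat_var n) : has_support nn good (fpexp (fpX v) (q - 1))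
    (eq^~ (monX v *+ (q - 1))).
  by apply: support_mono_exp => //; apply: supportX.
have hC (a : {ffun 'I_n -> bool}) : true -> _ := fun _ =>
  support_mono_mul pos
    (support_mono_prod pos (P := fun i => a i) (fun i _ => hX (inl i)))
    (support_mono_prod pos (P := satisfies a) (fun c _ => hX (inr c))).
apply: has_support_eq (support_sum pos hC) => M.
have E (a : {ffun 'I_n -> bool}) : \sum_(i | a i) monX (inl i) *+ (q - 1) +
    \sum_(c | satisfies a c) monX (inr c) *+ (q - 1) = sat_mon a.
  have pick (T : finType) (b : pred T) (x : T) (g : T -> bool) :
      (forall y, g y = (x == y)) ->
      (\sum_(y | b y) g y * (q - 1) = b x * (q - 1))%N.
    move=> gE; case bx: (b x).
      rewrite (bigD1 x) //= gE eqxx mul1n big1 ?addn0 // => y /andP[_ yx].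
      by rewrite gE eq_sym (negPf yx).
    rewrite big1 // => y yb; rewrite gE; case: eqP => // xy.
    by rewrite -xy bx in yb.
  apply/ffunP=> -[i|c]; rewrite !ffunE !mon_sumE.
    rewrite [X in _ + X]big1 ?addr0 => [|c _]; last by rewrite mon_mulnE monXE.
    under eq_bigr do rewrite mon_mulnE monXE.
    exact: pick.
  rewrite [X in X + _]big1 ?add0r => [|i _]; last by rewrite mon_mulnE monXE.
  under eq_bigr do rewrite mon_mulnE monXE.
  exact: (pick _ (satisfies a)).
by split=> [[a _ ->]|[a ->]]; exists a; rewrite ?E.
Qed.

Lemma three_literals (l1 l2 l3 : lit n) : l1 != l2 -> l1 != l3 -> l2 != l3 ->
  exists c : clause n, forall a, satisfies a c =
    [|| a l1.1 == l1.2, a l2.1 == l2.2 | a l3.1 == l3.2].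
Proof.
move=> n12 n13 n23.
have c3 : #|l1 |: [set l2; l3]| == 3%N.
  by rewrite cardsU1 cards2 !inE negb_or n12 n13 n23.
exists (Sub (l1 |: [set l2; l3]) c3 : clause n) => a; apply/existsP/or3P.
  move=> [l] /=; rewrite !inE.
  by case/andP=> /or3P[] /eqP -> h; [constructor 1|constructor 2|constructor 3].
by case=> h; [exists l1|exists l2|exists l3]; rewrite /= !inE eqxx ?orbT.
Qed.

Section Face.
Variables (k : nat) (v0 d : 'I_n) (p : 'I_k * 'I_k -> 'I_n).
Hypotheses (p_inj : injective p) (v0d : v0 != d).
Hypotheses (pv0 : forall x, p x != v0) (pd : forall x, p x != d).

Definition apex_assignment : {ffun 'I_n -> bool} := [ffun v => v == v0].
Definition perm_assignment (pi : 'S_k) : {ffun 'I_n -> bool} :=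
  [ffun v => [exists i, v == p (i, pi i)]].
Definition intended (a : {ffun 'I_n -> bool}) :=
  (a == apex_assignment) || [exists pi, a == perm_assignment pi].
(** All clauses true in every intended assignment, in place of an explicit formula; [conflict] shows
    that these suffice to exclude the forbidden pairs. *)
Definition constraints : {set clause n} :=
  [set c | [forall a, intended a ==> satisfies a c]].

Lemma perm_assignmentE pi x : perm_assignment pi (p x) = (x.2 == pi x.1).
Proof.
rewrite ffunE; apply/existsP/eqP => [[i /eqP/p_inj ->] //|E].
by exists x.1; rewrite -E -surjective_pairing.
Qed.

(* The variable [d] only pads the two-literal clause [~ u \/ ~ u'] to three
   literals, once with each sign. *)
Lemma conflict a u u' : u != u' -> u != d -> u' != d ->
  (forall a', intended a' -> ~~ (a' u && a' u')) ->
  {in constraints, forall c, satisfies a c} -> ~~ (a u && a u').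
Proof.
move=> uu' ud u'd conf sat.
have [||| c cE] := @three_literals (u, false) (u', false) (d, ~~ a d).
- by rewrite xpair_eqE (negPf uu').
- by rewrite xpair_eqE (negPf ud).
- by rewrite xpair_eqE (negPf u'd).
have /sat : c \in constraints.
  rewrite inE; apply/forall_inP => a' /conf; rewrite cE /=.
  by case: (a' u) (a' u') => [] [].
rewrite cE /=; case: (a u) (a u') => [] [] //=.
by case: (a d).
Qed.

Lemma intended_conflict x y a : intended a -> x != y ->
  (x.1 == y.1) || (x.2 == y.2) -> ~~ (a (p x) && a (p y)).
Proof.
move=> /orP[/eqP->|/existsP[pi /eqP->]]; first by rewrite !ffunE (negPf (pv0 x)).
rewrite !perm_assignmentE; case: x y => [i j] [i' j'] /= ne rc.
apply/negP => /andP[/eqP E /eqP E']; move: ne rc; rewrite E E' xpair_eqE.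
by rewrite (inj_eq perm_inj); case: (i == i').
Qed.

(** The weight k on [v0] puts the apex assignment level with the permutation matrices, which have k
    ones. *)
Definition ones (a : {ffun 'I_n -> bool}) : nat :=
  (a v0 * k + \sum_x a (p x))%N.

(** If [v0] is true it excludes every matrix entry. Otherwise each row and column has at most one
    true entry, and a total of k fills every row. *)
Lemma constraints_ones a : {in constraints, forall c, satisfies a c} ->
  (ones a <= k)%N /\ (ones a = k ->
    (forall x, a (p x) = false) \/
    a v0 = false /\ exists pi : 'S_k, forall x, a (p x) = (x.2 == pi x.1)).
Proof.
move=> sat.
have off x : ~~ (a v0 && a (p x)).
  apply: conflict sat => //; first by rewrite eq_sym.
  move=> a' /orP[/eqP->|/existsP[pi /eqP->]].
    by rewrite !ffunE (negPf (pv0 x)) andbF.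
  rewrite ffunE; apply/negP => /andP[/existsP[i /eqP E]].
  by have := pv0 (i, pi i); rewrite E eqxx.
have conf x y : x != y -> (x.1 == y.1) || (x.2 == y.2) -> ~~ (a (p x) && a (p y)).
  move=> ne rc; apply: conflict sat => //; first by rewrite (inj_eq p_inj).
  by move=> a' ia; apply: intended_conflict.
rewrite /ones; case av0: (a v0); rewrite /= ?mul1n ?mul0n ?add0n.
  have p0 x : a (p x) = false by have := off x; rewrite av0 => /negPf.
  by rewrite big1 ?addn0 => [|x _]; [split=> // _; left|rewrite p0].
have row i : (\sum_l a (p (i, l)) <= 1)%N.
  apply: sum_at_most_one => l l' al al'; apply/eqP/negPn/negP => ne.
  have := conf (i, l) (i, l'); rewrite xpair_eqE eqxx /= ne al al'.
  by move/(_ isT isT).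
have col l : (\sum_i a (p (i, l)) <= 1)%N.
  apply: sum_at_most_one => i i' al al'; apply/eqP/negPn/negP => ne.
  have := conf (i, l) (i', l); rewrite xpair_eqE eqxx /= andbT orbT ne al al'.
  by move/(_ isT isT).
have sumE : (\sum_x a (p x) = \sum_i \sum_l a (p (i, l)))%N.
  by rewrite pair_big; apply: eq_bigr => -[].
have sumk : (\sum_(i < k) 1 = k)%N by rewrite sum_nat_const card_ord muln1.
split; first by rewrite sumE -[X in (_ <= X)%N]sumk leq_sum.
rewrite sumE => Ek; right; split=> //.
have row1 i : (\sum_l a (p (i, l)) = 1)%N.
  apply/eqP; rewrite eqn_leq row /= leqNgt; apply/negP => lt1.
  have: (\sum_i \sum_l a (p (i, l)) < \sum_(i < k) 1)%N.
    rewrite (bigD1 i) //= [X in (_ < X)%N](bigD1 i) //=.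
    by rewrite -addSn leq_add ?leq_sum.
  by rewrite Ek sumk ltnn.
have [pi piP] := row_col_perm row1 col.
by exists pi => -[i l]; have := piP i l; case: (a _); case: (_ == _).
Qed.

(* [ones] is at most [k + k * k], so [k * k + 1] makes one violated clause of
   [constraints] cost more than the variables can gain. *)
Definition sat_weight (v : sat_var n) : nat :=
  match v with
  | inl u => ((v0 == u) * k + \sum_x (p x == u))%N
  | inr c => ((c \in constraints) * (k * k).+1)%N
  end.
Definition sat_value (a : {ffun 'I_n -> bool}) : nat :=
  (ones a + (k * k).+1 * #|[set c in constraints | satisfies a c]|)%N.
Definition sat_max : nat := (k + (k * k).+1 * #|constraints|)%N.

Lemma sat_weightE a :
  (\sum_v sat_weight v * sat_mon a v = sat_value a * (q - 1))%N.
Proof.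
rewrite big_sumType /= /sat_value mulnDl; congr (_ + _)%N.
  rewrite (eq_bigr (fun u => ((v0 == u) * k * a u +
     \sum_x (p x == u) * a u) * (q - 1))%N); last first.
    by move=> u _; rewrite ffunE mulnA mulnDl big_distrl.
  rewrite -big_distrl big_split /= exchange_big /=; congr ((_ + _) * _)%N.
    rewrite (bigD1 v0) //= eqxx mul1n mulnC big1 ?addn0 // => u ne.
    by rewrite eq_sym (negPf ne).
  apply: eq_bigr => x _; rewrite (bigD1 (p x)) //= eqxx mul1n big1 ?addn0 //.
  by move=> u ne; rewrite eq_sym (negPf ne).
rewrite -sum1_card big_distrr big_distrl /= big_mkcond [RHS]big_mkcond /=.
apply: eq_bigr => c _; rewrite ffunE [c \in [set _ in _ | _]]inE.
by case: (c \in _); case: (satisfies a c); rewrite ?mul0n ?mul1n ?muln0 ?muln1.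
Qed.

Lemma sat_value_max a : (sat_value a <= sat_max)%N /\
  (sat_value a = sat_max -> (forall x, a (p x) = false) \/
    a v0 = false /\ exists pi : 'S_k, forall x, a (p x) = (x.2 == pi x.1)).
Proof.
rewrite /sat_value /sat_max.
case: (boolP [forall c in constraints, satisfies a c]) => [/forall_inP sat|].
  have -> : [set c in constraints | satisfies a c] = constraints.
    by apply/setP=> c; rewrite inE; case: (boolP (c \in _)) => // /sat ->.
  have [le_k face] := constraints_ones sat.
  by rewrite leq_add2r; split=> // /eqP; rewrite eqn_add2r => /eqP.
rewrite negb_forall_in => /exists_inP[c cC cN].
have lt : (#|[set c in constraints | satisfies a c]| < #|constraints|)%N.
  apply: proper_card; apply/properP; split; last first.
    by exists c; rewrite // inE (negPf cN) andbF.
  by apply/subsetP=> c'; rewrite inE => /andP[].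
have ones_le : (ones a <= k + k * k)%N.
  rewrite leq_add //; first by case: (a v0); rewrite ?mul1n.
  rewrite -[X in (_ <= X * _)%N]card_ord -[X in (_ <= _ * X)%N]card_ord.
  by rewrite -card_prod -sum1_card leq_sum // => x _; apply: leq_b1.
have lt_max : (ones a + (k * k).+1 * #|[set c in constraints | satisfies a c]|
    < k + (k * k).+1 * #|constraints|)%N.
  apply: leq_ltn_trans (leq_add ones_le (leqnn _)) _.
  rewrite -addnA ltn_add2l -addSn -mulnS leq_mul2l.
  by rewrite lt orbT.
by split=> [|E]; [exact: ltnW|rewrite E ltnn in lt_max].
Qed.

Lemma intended_max a : intended a -> ones a = k -> sat_value a = sat_max.
Proof.
move=> ia ak; rewrite /sat_value ak; congr (_ + _ * #|pred_of_set _|)%N.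
apply/setP=> c; rewrite inE; case: (boolP (c \in _)) => // cC.
by move: cC; rewrite inE => /forall_inP/(_ a ia) ->.
Qed.

End Face.

Lemma Sat_perm_size (S : comNzSemiRingType) (le : S -> S -> Prop) m k j :
  totally_ordered_semiring le -> (2 <= q)%N -> (k * k + 2 <= n)%N ->
  (0 < j < k)%N -> mono_aff_proj le (Sat S q n) (Permanent S m) ->
  ('C(k, j) <= m)%N.
Proof.
move=> hS q2 kn jk proj.
have q1 : (0 < q - 1)%N by rewrite subn_gt0.
(* The two [option] layers supply [v0] and the padding variable [d], hence [k * k + 2]. *)
have [f f_inj] : exists f : option (option ('I_k * 'I_k)) -> 'I_n, injective f.
  by apply: injection_ord; rewrite !card_option card_prod card_ord -addn2.
pose v0 := f None; pose d := f (Some None); pose p x := f (Some (Some x)).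
have p_inj : injective p by move=> x y /f_inj[].
have v0d : v0 != d by rewrite (inj_eq f_inj).
have pv0 x : p x != v0 by rewrite (inj_eq f_inj).
have pd x : p x != d by rewrite (inj_eq f_inj).
have [E EP] := proj_perm_matchings hS (@support_Sat S) proj.
have wtE a : wt (fun v => (sat_weight v0 p v)%:Z) (sat_mon a) =
    (sat_value v0 p a * (q - 1))%N%:Z by rewrite wt_nat sat_weightE.
have max_ints a : intended v0 p a -> ones v0 p a = k ->
    wt (fun v => (sat_weight v0 p v)%:Z) (sat_mon a) = (sat_max v0 p * (q - 1))%N%:Z.
  by move=> ia ak; rewrite wtE intended_max.
apply: (perm_size_bound (w := fun v => (sat_weight v0 p v)%:Z)
   (beta := (sat_max v0 p * (q - 1))%N%:Z) (z := inl v0)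
   (rho := fun x => inl (p x)) EP _ q1) jk.
- move=> _ [a ->]; rewrite wtE lez_nat leq_mul2r.
  by have [-> _] := sat_value_max p_inj v0d pv0 pd a; rewrite orbT.
- by move=> x y [] /p_inj.
- move=> _ [a ->]; rewrite wtE => -[] /eqP; rewrite eqn_pmul2r // => /eqP aE.
  have [_ /(_ aE)[a0|[av0 [pi piP]]]] := sat_value_max p_inj v0d pv0 pd a.
    by left=> x; rewrite ffunE a0.
  right; split; first by rewrite ffunE av0.
  by exists pi => x; rewrite ffunE piP.
- exists (sat_mon (apex_assignment v0)); split; first by eexists.
    apply: max_ints; first by rewrite /intended eqxx.
    rewrite /ones !ffunE eqxx mul1n big1 ?addn0 // => x _.
    by rewrite ffunE (negPf (pv0 x)).
  by rewrite !ffunE eqxx mul1n.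
- move=> pi; exists (sat_mon (perm_assignment p pi)); split; first by eexists.
    apply: max_ints.
      by rewrite /intended; apply/orP; right; apply/existsP; exists pi.
    rewrite /ones ffunE; case: existsP => [[i /eqP E0]|_].
      by have := pv0 (i, pi i); rewrite E0 eqxx.
    rewrite add0n (eq_bigr (fun x => (x.2 == pi x.1) : nat)); last first.
      by move=> x _; rewrite perm_assignmentE.
    rewrite -(pair_bigA _ (fun i l => (l == pi i) : nat)) /=.
    rewrite (eq_bigr (fun=> 1%N)) ?sum_nat_const ?card_ord ?muln1 // => i _.
    rewrite (bigD1 (pi i)) //= eqxx big1 ?addn0 // => l ne.
    by rewrite (negPf ne).
  by move=> i; rewrite ffunE perm_assignmentE // eqxx mul1n.
Qed.

End Sat.

(** * The face of Clow *)

Section Clow.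
Variables (q n : nat).
Implicit Type w : {ffun 'I_n -> 'I_n}.

Definition step w (t : 'I_n) : {set 'I_n} := [set w t; w (ordS t)].

Definition clow_mon w : mon (clow_var n) :=
  [ffun v => match v with
             | inl e => (\sum_t (step w t == val e)) * (q - 1)
             | inr u => (u \in codom w) * (q - 1)
             end]%N.

Lemma edge_exists (x y : 'I_n) : x != y -> exists e : edge n, val e = [set x; y].
Proof.
move=> xy; have e2 : #|[set x; y]| == 2%N by rewrite cards2 xy.
by exists (Sub [set x; y] e2).
Qed.

Lemma support_Clow (S : comNzSemiRingType) (nn good : S -> Prop) :
  positivity nn good ->
  has_support nn good (Clow S q n)
    (fun M => exists2 w, closed_walk w && min_start w & M = clow_mon w).
Proof.
move=> pos.
(* Consecutive vertices of a closed walk differ, so the default [fp0] of [edgeX] never occurs. *)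
have hE (x y : 'I_n) : x != y -> has_support nn good (fpexp (edgeX S x y) (q - 1))
    (eq^~ ([ffun v : clow_var n => if v is inl e then ([set x; y] == val e) : nat
       else 0%N] *+ (q - 1))).
  move=> xy; apply: support_mono_exp => //; have [e eE] := edge_exists xy.
  rewrite /edgeX -eE valK; apply: has_support_eq (supportX pos (inl e)) => M.
  rewrite (_ : [ffun _ => _] = monX (inl e)) //.
  by apply/ffunP=> -[e'|v]; rewrite !ffunE // eE -eE (inj_eq val_inj) eq_sym.
have hV (v : 'I_n) : has_support nn good (fpexp (fpX (inr v : clow_var n)) (q - 1))
    (eq^~ (monX (inr v) *+ (q - 1))).
  by apply: support_mono_exp => //; apply: supportX.
have hw w : closed_walk w && min_start w -> _ := fun hw =>
  support_mono_mul pos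
    (support_mono_prod pos (P := predT) (fun t _ => hE (w t) (w (ordS t))
       (forallP (proj1 (andP hw)) t)))
    (support_mono_prod pos (P := fun v => v \in codom w) (fun v _ => hV v)).
apply: has_support_eq (support_sum pos hw) => M.
have EM w : \sum_t [ffun v : clow_var n =>
      if v is inl e then ([set w t; w (ordS t)] == val e) : nat else 0%N] *+ (q - 1) +
    \sum_(v in codom w) monX (inr v) *+ (q - 1) = clow_mon w.
  apply/ffunP=> -[e|u]; rewrite !ffunE !mon_sumE.
    rewrite [X in _ + X]big1 ?addr0 => [|v _]; last by rewrite mon_mulnE monXE.
    by rewrite big_distrl; apply: eq_bigr => t _; rewrite mon_mulnE ffunE.
  rewrite [X in X + _]big1 ?add0r => [|t _]; last by rewrite mon_mulnE ffunE.
  under eq_bigr do rewrite mon_mulnE monXE.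
  case: (boolP (u \in _)) => uw.
    rewrite (bigD1 u) //= eqxx mul1n big1 ?addn0 // => v /andP[_ ne].
    by rewrite (inj_eq (@inr_inj _ _)) eq_sym (negPf ne).
  rewrite big1 // => v vw; rewrite (inj_eq (@inr_inj _ _)); case: eqP => // uv.
  by rewrite uv vw in uw.
by split=> -[w cw ->]; exists w; rewrite ?EM.
Qed.

(** A linear functional on exponents becomes a sum along the walk: edges count with multiplicity,
    visited vertices once. *)
Lemma clow_sum (g : {set 'I_n} -> nat) (h : 'I_n -> nat) w : closed_walk w ->
  (\sum_(v : clow_var n) (match v with inl e => g (val e) | inr u => h u end) *
     clow_mon w v = (\sum_t g (step w t) + \sum_(v in codom w) h v) * (q - 1))%N.
Proof.
move=> /forallP cw; rewrite big_sumType /= mulnDl; congr (_ + _)%N.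
  under eq_bigr do rewrite ffunE mulnA big_distrr /=.
  rewrite -big_distrl exchange_big /=; congr (_ * _)%N; apply: eq_bigr => t _.
  have [e eE] := edge_exists (cw t); rewrite (bigD1 e) //= /step -eE eqxx muln1.
  rewrite big1 ?addn0 // => e' ne; rewrite (inj_eq val_inj) eq_sym (negPf ne).
  by rewrite muln0.
rewrite [in RHS]big_mkcond big_distrl /=; apply: eq_bigr => v _; rewrite ffunE.
by case: (v \in _); rewrite ?mul1n ?mul0n ?muln0.
Qed.

Lemma sum_ordS (g : 'I_n -> nat) : (\sum_t g (ordS t) = \sum_t g t)%N.
Proof. by rewrite [RHS](reindex_inj (@ordS_inj n)). Qed.

Lemma ordS_val (t : 'I_n) : (t.+1 < n)%N -> ordS t = t.+1 :> nat.
Proof. by move=> lt; rewrite /= modn_small. Qed.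

Lemma ordS_wrap (t : 'I_n) : (n <= t.+1)%N -> ordS t = 0%N :> nat.
Proof.
move=> ge; have /eqP : t.+1 == n by rewrite eqn_leq ge ltn_ord.
by move=> /= ->; rewrite modnn.
Qed.

Lemma ordS_constant (T : Type) (g : 'I_n -> T) : (forall t, g (ordS t) = g t) ->
  forall t t', g t = g t'.
Proof.
move=> gS; suff H (i j : nat) (lti : (i + j < n)%N) (ltj : (i < n)%N) :
    g (Ordinal lti) = g (Ordinal ltj).
  have g0 (t : 'I_n) : exists lt0 : (0 < n)%N, g t = g (Ordinal lt0).
    have lt0 : (0 < n)%N by apply: leq_ltn_trans (ltn_ord t).
    exists lt0; rewrite -(H 0%N t (ltn_ord t) lt0); congr g; exact: val_inj.
  move=> t t'; have [l0 ->] := g0 t; have [l1 ->] := g0 t'.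
  by congr g; apply: val_inj.
elim: j lti => [|j IH] lti; first by congr g; apply: val_inj => /=; rewrite addn0.
have ltj' : (i + j < n)%N by apply: leq_trans lti; rewrite addnS ltnS ltnW.
rewrite -(IH ltj') -[RHS]gS; congr g; apply: val_inj.
by rewrite /= modn_small -addnS.
Qed.

(** Each visit to [x] lies on the step entering it and on the step leaving it, and no step has both
    ends at [x]. *)
Lemma sum_mem_step w x : closed_walk w ->
  (\sum_t (x \in step w t) = 2 * \sum_t (w t == x))%N.
Proof.
move=> /forallP cw; rewrite mul2n -addnn.
rewrite -[X in (_ = _ + X)%N](sum_ordS (fun t => w t == x)) -big_split /=.
apply: eq_bigr => t _; rewrite !inE ![x == _]eq_sym.
case: (w t =P x) (cw t) => [-> ne|_ _] //=.
by rewrite [w (ordS t) == x]eq_sym (negPf ne).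
Qed.

(* The face consists of walks inside [{0, 1, 2}] and of walks avoiding these
   vertices that traverse each of the [2 k] edges [link p] exactly once and visit
   its ends only then.  In [p = (b, i)], [b] tells rows from columns.  An inner
   vertex [inn p] may only be joined to [out p] or to inner vertices of the other
   side, so each row is joined to exactly one column.  For an unrestricted walk,
   with [x] the number of uses of [link p] and [a], [b] the numbers of visits
   to its ends, the inequality is [x + 4 [a > 0] + 4 [b > 0] <= 4 a + 4 b + 1]
   ([pair_tradeoff]); the constant [1] is homogenised into [2 k] per edge outside
   [{0, 1, 2}], which is why everything else is scaled by [n]. *)
Section Gadget.
Variables (k : nat) (enc : bool * (bool * 'I_k) -> 'I_n).
Hypotheses (enc_inj : injective enc) (enc_ge : forall x, (6 <= enc x)%N).
Hypothesis n3 : (2 < n)%N.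

Definition inn (p : bool * 'I_k) := enc (true, p).
Definition out (p : bool * 'I_k) := enc (false, p).
Definition link p : {set 'I_n} := [set inn p; out p].
(** Vertices 0, 1, 2 are low; 3, 4, 5 are left for the start and the filler of [perm_walk], and the
    gadget begins at 6. *)
Definition low (v : 'I_n) := (v < 3)%N.
Definition low_edge (e : {set 'I_n}) := [forall v in e, low v].
Definition good_edge (e : {set 'I_n}) := low_edge e ||
  [forall v in e, ~~ low v] &&
  [forall p, (inn p \in e) ==>
     (out p \in e) || [exists l, inn (~~ p.1, l) \in e]].

Definition neg_edge (e : {set 'I_n}) := (n * \sum_p (e == link p))%N.
Definition neg_vertex (v : 'I_n) := (4 * n * \sum_x (v == enc x))%N.
(** Each visit lies on two steps, so [2 * n] per end makes [4 * n] per visit. The last term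
    outweighs [n * n], the most that links can earn in n steps. *)
Definition pos_edge (e : {set 'I_n}) := (2 * n * \sum_x (enc x \in e)
  + 2 * k * ~~ low_edge e + (n * n).+1 * ~~ good_edge e)%N.

Section Walk.
Variable w : {ffun 'I_n -> 'I_n}.
Hypothesis cw : closed_walk w.

Definition visits x := (\sum_t (w t == enc x))%N.
Definition links p := (\sum_t (step w t == link p))%N.
Definition reward : nat :=
  (\sum_t neg_edge (step w t) + \sum_(v in codom w) neg_vertex v)%N.
Definition cost : nat := (\sum_t pos_edge (step w t) + \sum_(v in codom w) 0)%N.

Lemma visits_gt0 x : (enc x \in codom w) = (0 < visits x)%N.
Proof.
rewrite lt0n sum_nat_eq0 negb_forall; apply/codomP/existsP => -[t].
  by move=> ->; exists t; rewrite eqxx.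
by rewrite /= eqb0 negbK => /eqP <-; exists t.
Qed.

Lemma rewardE : reward = (n * \sum_p links p + 4 * n * \sum_x (0 < visits x))%N.
Proof.
rewrite /reward /neg_edge /neg_vertex -!big_distrr exchange_big /=.
congr (_ + _ * _)%N; rewrite exchange_big /=; apply: eq_bigr => x _.
rewrite -visits_gt0 big_mkcond (bigD1 (enc x)) //= eqxx big1 ?addn0.
  by case: (_ \in _).
by move=> v ne; rewrite (negPf ne); case: ifP.
Qed.

Lemma costE : cost = (4 * n * \sum_x visits x + 2 * k * \sum_t ~~ low_edge (step w t)
  + (n * n).+1 * \sum_t ~~ good_edge (step w t))%N.
Proof.
rewrite /cost big1_eq addn0 /pos_edge !big_split -!big_distrr exchange_big /=.
congr (_ + _ + _)%N; rewrite (eq_bigr _ (fun x _ => sum_mem_step (enc x) cw)).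
by rewrite -big_distrr /= mulnA; congr (_ * _)%N; lia.
Qed.

Lemma link_inj : injective link.
Proof.
move=> p p' /setP/(_ (inn p)); rewrite !inE eqxx /= => /esym.
by rewrite !(inj_eq enc_inj) !xpair_eqE /= orbF => /eqP.
Qed.

Lemma links_le p : (links p <= 2 * visits (true, p))%N /\
  (links p <= 2 * visits (false, p))%N.
Proof.
by split; rewrite -sum_mem_step // leq_sum // => t _;
  case: eqP => [->|_] //; rewrite !inE eqxx ?orbT.
Qed.

Lemma visits1 x t t' : visits x = 1%N -> w t = enc x -> w t' = enc x -> t = t'.
Proof.
move=> v1 wt wt'; apply/eqP/negPn/negP => ne; move: v1.
rewrite /visits (bigD1 t) //= wt eqxx (bigD1 t') 1?eq_sym //= wt' eqxx.
by rewrite addnCA.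
Qed.

(** Two uses in the same direction would revisit an end. Two in opposite directions, with single
    visits, would close the walk after two steps, against n > 2. *)
Lemma links_le1 p : visits (true, p) = 1%N -> visits (false, p) = 1%N ->
  (links p <= 1)%N.
Proof.
move=> v1 v2; apply: sum_at_most_one => t t' /eqP st /eqP st'.
have ends (u : 'I_n) : step w u = link p ->
    w u = inn p /\ w (ordS u) = out p \/ w u = out p /\ w (ordS u) = inn p.
  move=> su; have: w u \in link p by rewrite -su !inE eqxx.
  have: w (ordS u) \in link p by rewrite -su !inE eqxx orbT.
  have /eqP := forallP cw u.
  by rewrite !inE => ne /orP[]/eqP a /orP[]/eqP b; [|right|left|]; rewrite ?a ?b //;
     rewrite a b in ne.
have noback (u u' : 'I_n) : ordS u = u' -> ordS u' = u -> u = u'.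
  move=> <- {u'} uu; have [lt|ge] := ltnP u.+1 n.
    have [lt'|ge'] := ltnP u.+2 n.
      have := congr1 val uu; rewrite /= modn_small /= modn_small //; lia.
    have E : ordS (ordS u) = 0%N :> nat by rewrite ordS_wrap // ordS_val.
    rewrite uu in E; move: ge'; rewrite E; lia.
  have E := ordS_wrap ge; have : ordS (ordS u) = 1%N :> nat.
    by rewrite ordS_val E //; lia.
  by rewrite uu => E1; move: ge; rewrite E1; lia.
case: (ends _ st) (ends _ st') => -[a b] [] [a' b'].
- exact: visits1 v1 a a'.
- by apply: noback; [exact: visits1 v2 b a'|exact: visits1 v1 b' a].
- by apply: noback; [exact: visits1 v1 b a'|exact: visits1 v2 b' a].
- exact: visits1 v2 a a'.
Qed.

(** An extra visit to an end costs 4 but admits at most 2 more links, and an unvisited end gives L =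
    0 and misses the constant 1; equality leaves single visits to both ends. *)
Lemma pair_tradeoff a b L : (L <= 2 * a)%N -> (L <= 2 * b)%N ->
  (a = 1 -> b = 1 -> L <= 1)%N ->
  (L + 4 * (0 < a) + 4 * (0 < b) <= 4 * a + 4 * b + 1)%N /\
  (L + 4 * (0 < a) + 4 * (0 < b) = 4 * a + 4 * b + 1 ->
    [/\ L = 1, a = 1 & b = 1])%N.
Proof.
move=> La Lb L1; case: a La L1 => [|[|a]] La L1; case: b Lb L1 => [|[|b]] Lb L1;
  by split; [|split]; move: (L1); rewrite /=; lia.
Qed.

(** A good edge never joins a low vertex to one that is not low, so lowness is constant around the
    walk. *)
Lemma low_dichotomy : (forall t, good_edge (step w t)) ->
  (forall t, low_edge (step w t)) \/ (forall t, ~~ low (w t)).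
Proof.
move=> good; have const t : low (w (ordS t)) = low (w t).
  case/orP: (good t) => [/forall_inP lo|/andP[/forall_inP hi _]].
    by rewrite !lo // !inE eqxx ?orbT.
  by rewrite !(negPf (hi _ _)) // !inE eqxx ?orbT.
have lowE := ordS_constant const.
case: (boolP [forall t, low (w t)]) => [/forallP lo|].
  by left=> t; apply/forall_inP => v; rewrite !inE => /orP[]/eqP->.
rewrite negb_forall => /existsP[t hi]; right=> t'.
by rewrite (lowE t' t).
Qed.

Definition low_walk := forall t, low_edge (step w t).
Definition gadget_walk := [/\ forall t, good_edge (step w t),
  forall t, ~~ low (w t) & forall p, [/\ links p = 1, visits (true, p) = 1 &
  visits (false, p) = 1]]%N.

Lemma sum_pairs (g : bool * (bool * 'I_k) -> nat) :
  (\sum_x g x = \sum_p (g (true, p) + g (false, p)))%N.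
Proof.
transitivity (\sum_x g (x.1, x.2))%N; first by apply: eq_bigr => -[].
rewrite big_split /=.
by rewrite -(pair_bigA _ (fun c p => g (c, p))) /= big_bool.
Qed.

Lemma low_walk_tight : low_walk -> reward = cost.
Proof.
move=> lo; rewrite rewardE costE.
have vis0 x : visits x = 0%N.
  rewrite /visits big1 // => t _; case: eqP => // wx.
  have /forall_inP/(_ (w t)) := lo t; rewrite !inE eqxx wx => /(_ isT).
  by rewrite /low ltnNge (leq_trans _ (enc_ge x)).
have -> : (\sum_p links p = 0)%N.
  by rewrite big1 // => p _; have [] := links_le p; rewrite vis0 leqn0 => /eqP.
have -> : (\sum_x (0 < visits x) = 0)%N by rewrite big1 // => x _; rewrite vis0.
have -> : (\sum_x visits x = 0)%N by rewrite big1.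
have -> : (\sum_t ~~ low_edge (step w t) = 0)%N.
  by rewrite big1 // => t _; rewrite lo.
have -> : (\sum_t ~~ good_edge (step w t) = 0)%N.
  by rewrite big1 // => t _; rewrite /good_edge lo.
by rewrite !muln0.
Qed.

Lemma reward_le_cost : (reward <= cost)%N /\
  (reward = cost -> low_walk \/ gadget_walk).
Proof.
rewrite rewardE costE.
have vis_le : (\sum_x (0 < visits x) <= \sum_x visits x)%N.
  by apply: leq_sum => x _; case: (visits x).
case: (boolP [forall t, good_edge (step w t)]) => [/forallP good|]; last first.
  rewrite negb_forall => /existsP[t0 bad].
  have bad1 : (1 <= \sum_t ~~ good_edge (step w t))%N.
    by rewrite (bigD1 t0) //= bad.
  have links_n : (\sum_p links p <= n)%N.
    rewrite /links exchange_big /= -[X in (_ <= X)%N]card_ord -sum1_card leq_sum //.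
    move=> t _; apply: sum_at_most_one => p p' /eqP-> /eqP; exact: link_inj.
  have lt : (n * \sum_p links p + 4 * n * \sum_x (0 < visits x) <
     4 * n * \sum_x visits x + 2 * k * \sum_t ~~ low_edge (step w t) +
     (n * n).+1 * \sum_t ~~ good_edge (step w t))%N.
    have h1 := leq_mul (leqnn n) links_n.
    have h2 := leq_mul (leqnn (4 * n)%N) vis_le.
    have h3 := leq_mul (leqnn (n * n).+1) bad1.
    lia.
  by split=> [|E]; [exact: ltnW|rewrite E ltnn in lt].
have ngood : (\sum_t ~~ good_edge (step w t) = 0)%N.
  by rewrite big1 // => t _; rewrite good.
rewrite ngood muln0 addn0.
case: (low_dichotomy good) => [lo|hi].
  have := low_walk_tight lo; rewrite rewardE costE ngood muln0 addn0 => ->.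
  by split=> // _; left.
have -> : (\sum_t ~~ low_edge (step w t) = n)%N.
  rewrite (eq_bigr (fun=> 1%N)) ?sum_nat_const ?card_ord ?muln1 // => t _.
  case: (boolP (low_edge _)) => // /forall_inP/(_ (w t)).
  by rewrite !inE eqxx (negPf (hi t)) => /(_ isT).
have key p := pair_tradeoff (links_le p).1 (links_le p).2 (@links_le1 p).
have EL : (n * \sum_p links p + 4 * n * \sum_x (0 < visits x) =
    n * \sum_p (links p + 4 * (0 < visits (true, p)) + 4 * (0 < visits (false, p))))%N.
  rewrite sum_pairs !big_split /= big1_eq; lia.
(* Without low vertices all n steps are charged 2k, which is n units for each of the 2k pairs: the
   constant 1 of [pair_tradeoff]. *)
have ER : (4 * n * \sum_x visits x + 2 * k * n =
    n * \sum_p (4 * visits (true, p) + 4 * visits (false, p) + 1))%N.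
  rewrite sum_pairs !big_split /= big1_eq sum_nat_const card_prod card_bool.
  by rewrite card_ord; lia.
rewrite EL ER leq_mul2l leq_sum ?orbT => [|p _]; last by have [] := key p.
split=> // /eqP; rewrite eqn_pmul2l; last by lia.
move=> /eqP E; right; split=> // p; have [_] := key p; apply.
(* Equality of the sums forces equality in each pair. *)
have [_] : (\sum_p (links p + 4 * (0 < visits (true, p)) + 4 * (0 < visits (false, p)))
  <= \sum_p (4 * visits (true, p) + 4 * visits (false, p) + 1) ?= iff 
    [forall p, links p + 4 * (0 < visits (true, p)) + 4 * (0 < visits (false, p)) ==
    4 * visits (true, p) + 4 * visits (false, p) + 1])%N.
  by apply: leqif_sum => p' _; split=> //; have [] := key p'.
by rewrite E eqxx => /esym/forallP/(_ p)/eqP.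
Qed.

(** The variable of this edge plays [rho (i, l)]. *)
Definition cross (i l : 'I_k) : {set 'I_n} := [set inn (true, i); inn (false, l)].
Definition crossings i l := (\sum_t (step w t == cross i l))%N.

Lemma inner_edge b i t : gadget_walk ->
  ((inn (b, i) \in step w t) =
    (step w t == link (b, i)) +
    \sum_l (step w t == [set inn (b, i); inn (~~ b, l)]) :> nat)%N.
Proof.
move=> [good hi _]; set p := (b, i).
have other v : v != inn p -> v \in step w t -> inn p \in step w t ->
    step w t = [set inn p; v].
  move=> ne vs ps; apply/esym/eqP; rewrite eqEcard subUset !sub1set vs ps /=.
  by rewrite !cards2 [inn p == v]eq_sym ne; case: (_ != _).
have out_inn : out p != inn p by rewrite (inj_eq enc_inj).
have inn_inn l : inn (~~ b, l) != inn p.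
  by rewrite (inj_eq enc_inj) !xpair_eqE; case: b {p other out_inn}.
case: (boolP (inn p \in step w t)) => ps; last first.
  rewrite big1 => [|l _]; first by case: eqP ps => // ->; rewrite !inE eqxx.
  by case: eqP ps => // ->; rewrite !inE eqxx.
have {}hi : low_edge (step w t) = false.
  apply/negbTE; apply/negP => /forall_inP/(_ (w t)).
  by rewrite !inE eqxx (negPf (hi t)) => /(_ isT).
have := good t; rewrite /good_edge hi /= => /andP[_ /forallP/(_ p)].
rewrite ps /= => /orP[os|/existsP[l ls]].
  rewrite (other _ out_inn os ps) eqxx big1 // => l _; case: eqP => // /setP/(_ (out p)).
  rewrite !inE eqxx orbT (negPf out_inn) /= => /esym.
  by rewrite (inj_eq enc_inj).
rewrite (other _ (inn_inn l) ls ps) (bigD1 l) //= eqxx big1 ?addn0.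
  case: eqP => // /setP/(_ (out p)); rewrite !inE eqxx orbT (negPf out_inn) /=.
  by rewrite (inj_eq enc_inj).
move=> l' ne; case: eqP => // /setP/(_ (inn (~~ b, l'))).
rewrite !inE eqxx orbT (negPf (inn_inn l')) /= (inj_eq enc_inj) !xpair_eqE /=.
by rewrite eqxx (negPf ne).
Qed.

(** One visit lies on two steps; the link is one of them, so exactly one step leads to the other
    side. *)
Lemma inner_degree b i : gadget_walk ->
  (\sum_l \sum_t (step w t == [set inn (b, i); inn (~~ b, l)]) = 1)%N.
Proof.
move=> gw; have [_ _ /(_ (b, i))[L1 V1 _]] := gw.
have := sum_mem_step (inn (b, i)) cw.
rewrite (eq_bigr _ (fun t _ => inner_edge b i t gw)) big_split /=.
rewrite -[X in (X + _)%N]/(links (b, i)) -[X in (2 * X)%N]/(visits _) L1 V1.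
by rewrite exchange_big /=; lia.
Qed.

Lemma gadget_walk_perm : gadget_walk ->
  exists pi : 'S_k, forall i l, crossings i l = (l == pi i).
Proof.
move=> gw; apply: row_col_perm => [i|l]; first exact: (inner_degree true i gw).
rewrite leq_eqVlt -[X in X || _]/(_ == _) -(inner_degree false l gw) /=.
apply/orP; left; apply/eqP; apply: eq_bigr => i _; apply: eq_bigr => t _.
by rewrite /cross setUC.
Qed.

End Walk.

Definition clow_weight (v : clow_var n) : int :=
  (match v with inl e => neg_edge (val e) | inr u => neg_vertex u end)%:Z -
  (match v with inl e => pos_edge (val e) | inr u => 0%N end)%:Z.

Lemma clow_weightE w : closed_walk w ->
  wt clow_weight (clow_mon w) = (reward w * (q - 1))%N%:Z - (cost w * (q - 1))%N%:Z.
Proof.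
move=> cw.
rewrite /reward /cost -(clow_sum neg_edge neg_vertex cw).
rewrite -(clow_sum pos_edge (fun=> 0%N) cw) -!wt_nat /wt -sumrB.
by apply: eq_bigr => v _; rewrite mulrnBl.
Qed.

(** * Walks realising the permutations *)

Section PermWalk.
Hypothesis n_big : (4 * k + 6 <= n)%N.
Variable pi : 'S_k.

(* The walk is [3], then [out, inn] of row [i] and [inn, out] of column [pi i]
   for each [i], then [4] and [5] alternately. *)
Definition time (x : bool * (bool * 'I_k)) : nat :=
  let: (c, (b, i)) := x in
  if b then (4 * i + 1 + c)%N else (4 * (pi^-1)%g i + 4 - c)%N.

Lemma time_bounds x : (0 < time x <= 4 * k)%N.
Proof.
case: x => [c [[] i]] /=; first by have := ltn_ord i; case: c => /=; lia.
by have := ltn_ord ((pi^-1)%g i); case: c => /=; lia.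
Qed.

(** The residue modulo 4 determines the side and whether the vertex is inner or outer; the index is
    then recovered, for columns through [pi]. *)
Lemma time_inj : injective time.
Proof.
move=> [c [b i]] [c' [b' i']] /=.
have ii : (i : nat) = i' -> i = i' by apply: val_inj.
have pii : ((pi^-1)%g i : nat) = (pi^-1)%g i' -> i = i'.
  by move=> /(@val_inj _ _ _ _ _)/perm_inj.
case: b b' c c' => [] [] [] [] E; try (by [rewrite ii //; lia|rewrite pii //; lia]).
all: exfalso; lia.
Qed.

Let n_gt3 : (3 < n)%N. Proof. by lia. Qed.
Let n_gt4 : (4 < n)%N. Proof. by lia. Qed.
Let n_gt5 : (5 < n)%N. Proof. by lia. Qed.

Definition perm_walk : {ffun 'I_n -> 'I_n} :=
  [ffun t : 'I_n => if [pick x | time x == t] is Some x then enc x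
   else if t == 0%N :> nat then Ordinal n_gt3
   else if odd t then Ordinal n_gt4 else Ordinal n_gt5].

Lemma perm_walk_enc x (t : 'I_n) : (perm_walk t == enc x) = (time x == t).
Proof.
rewrite ffunE; case: pickP => [y /eqP yt|none].
  by rewrite (inj_eq enc_inj) -yt (inj_eq time_inj) eq_sym.
rewrite none; apply/negbTE/negP => /eqP/(congr1 (@nat_of_ord n)) /=.
by have := enc_ge x; case: ifP => _; [|case: ifP => _] => /= ? ?; lia.
Qed.

Lemma perm_walk_cases (t : 'I_n) : (exists2 x, time x = t & perm_walk t = enc x) \/
  (perm_walk t = (if t == 0%N :> nat then 3 else if odd t then 4 else 5)%N :> nat /\
   forall x, time x <> t).
Proof.
rewrite ffunE; case: pickP => [y /eqP yt|none]; first by left; exists y.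
by right; split=> [|x /eqP]; [case: ifP => _; [|case: ifP]|rewrite none].
Qed.

Lemma perm_walk0 (t : 'I_n) : t = 0%N :> nat -> perm_walk t = 3%N :> nat.
Proof.
move=> t0; case: (perm_walk_cases t) => [[x xt _]|[-> _]]; last by rewrite t0.
by have := time_bounds x; rewrite xt t0.
Qed.

Lemma perm_walk_pos (t : 'I_n) : (0 < t)%N -> (3 < perm_walk t)%N.
Proof.
move=> t0; case: (perm_walk_cases t) => [[x _ ->]|[-> _]].
  by apply: leq_trans (enc_ge x).
by case: eqP => [t0'|_]; [rewrite t0' in t0|case: odd].
Qed.

(** Vertex 3 occurs only at time 0, each gadget vertex only once, and the filler alternates by
    parity. *)
Lemma perm_walk_closed : closed_walk perm_walk.
Proof.
apply/forallP=> t; apply/negP => /eqP E.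
have [lt|ge] := ltnP t.+1 n; last first.
  have := perm_walk0 (ordS_wrap ge); rewrite -E => E3.
  have := @perm_walk_pos t; rewrite E3 => /(_ _); have := ordS_wrap ge.
  by move: n3 ge; lia.
case: (posnP t) => [t0|t_gt0].
  have := perm_walk0 t0; rewrite E => E3.
  by have := @perm_walk_pos (ordS t); rewrite E3 ordS_val // => /(_ isT).
case: (perm_walk_cases t) => [[x xt wx]|[wt nt]].
  have /eqP : perm_walk (ordS t) = enc x by rewrite -E.
  by rewrite perm_walk_enc ordS_val // xt => /eqP; lia.
case: (perm_walk_cases (ordS t)) => [[x xt wx]|[wt' _]].
  by have /eqP := wx; rewrite -E perm_walk_enc => /eqP /nt.
move: wt'; rewrite -E wt ordS_val //= (gtn_eqF t_gt0).
by case: odd.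
Qed.

Lemma perm_walk_min : min_start perm_walk.
Proof.
apply/forallP=> t; apply/forallP=> t'; apply/implyP=> /andP[/eqP t'0].
by rewrite -lt0n (perm_walk0 t'0) => /perm_walk_pos.
Qed.

Lemma time_lt x : (time x < n)%N.
Proof. by have := time_bounds x; lia. Qed.

Lemma perm_walk_time x : perm_walk (Ordinal (time_lt x)) = enc x.
Proof. by apply/eqP; rewrite perm_walk_enc. Qed.

Lemma perm_walk_next x y (t : 'I_n) : time y = (time x).+1 -> time x = t ->
  perm_walk (ordS t) = enc y.
Proof.
move=> xy xt; apply/eqP; rewrite perm_walk_enc ordS_val ?xy ?xt //.
by rewrite -xt -xy time_lt.
Qed.

Lemma perm_walk_prev x y (t : 'I_n) : time y = (time x).+1 -> time y = ordS t ->
  perm_walk t = enc x.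
Proof.
move=> xy yt; apply/eqP; rewrite perm_walk_enc.
have [lt|ge] := ltnP t.+1 n; last by move: yt; rewrite xy ordS_wrap.
by move: yt; rewrite xy ordS_val // => -[->].
Qed.

Lemma time_out_inn i : time (true, (true, i)) = (time (false, (true, i))).+1.
Proof. by rewrite /=; lia. Qed.

Lemma time_inn_inn i : time (true, (false, pi i)) = (time (true, (true, i))).+1.
Proof. by rewrite /= permK; lia. Qed.

Lemma time_inn_out i : time (false, (false, i)) = (time (true, (false, i))).+1.
Proof. by rewrite /=; lia. Qed.

Lemma perm_walk_visits x : visits perm_walk x = 1%N.
Proof.
rewrite /visits; under eq_bigr do rewrite perm_walk_enc.
rewrite (bigD1 (Ordinal (time_lt x))) //= eqxx big1 // => t ne.
by case: eqP => // xt; case/eqP: ne; apply: val_inj.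
Qed.

Lemma perm_walk_high t : ~~ low (perm_walk t).
Proof.
rewrite /low -leqNgt; case: (posnP t) => [/perm_walk0 ->//|/perm_walk_pos].
exact: ltnW.
Qed.

Lemma perm_walk_step x y : time y = (time x).+1 ->
  step perm_walk (Ordinal (time_lt x)) = [set enc x; enc y].
Proof.
by move=> xy; rewrite /step perm_walk_time (@perm_walk_next x y).
Qed.

Lemma perm_walk_good t : good_edge (step perm_walk t).
Proof.
rewrite /good_edge; apply/orP; right; apply/andP; split.
  by apply/forall_inP => v; rewrite !inE => /orP[]/eqP->; apply: perm_walk_high.
apply/forallP=> -[b i]; apply/implyP; rewrite !inE.
move=> /orP[]; rewrite eq_sym perm_walk_enc.
  move=> /eqP it; case: b it => it; apply/orP; [right|left].
    apply/existsP; exists (pi i); rewrite /= !inE.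
    by rewrite (perm_walk_next (time_inn_inn i) it) eqxx orbT.
  by rewrite /out (perm_walk_next (time_inn_out i) it) eqxx orbT.
move=> /eqP it; case: b it => it; apply/orP; [left|right].
  by rewrite /out (perm_walk_prev (time_out_inn i) it) eqxx.
apply/existsP; exists ((pi^-1)%g i); rewrite /= !inE.
have := time_inn_inn ((pi^-1)%g i); rewrite permKV => e.
by rewrite (perm_walk_prev e it) eqxx.
Qed.

Lemma perm_walk_links p : links perm_walk p = 1%N.
Proof.
apply/eqP; rewrite eqn_leq links_le1 ?perm_walk_visits //=; last exact: perm_walk_closed.
case: p => [[] i]; rewrite /links.
  rewrite (bigD1 (Ordinal (time_lt (false, (true, i))))) //=.
  by rewrite (perm_walk_step (time_out_inn i)) /link setUC eqxx.
rewrite (bigD1 (Ordinal (time_lt (true, (false, i))))) //=.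
by rewrite (perm_walk_step (time_inn_out i)) eqxx.
Qed.

Lemma perm_walk_tight : reward perm_walk = cost perm_walk.
Proof.
rewrite rewardE costE; last exact: perm_walk_closed.
have -> : (\sum_t ~~ good_edge (step perm_walk t) = 0)%N.
  by rewrite big1 // => t _; rewrite perm_walk_good.
have -> : (\sum_t ~~ low_edge (step perm_walk t) = n)%N.
  rewrite (eq_bigr (fun=> 1%N)) ?sum_nat_const ?card_ord ?muln1 // => t _.
  case: (boolP (low_edge _)) => // /forall_inP/(_ (perm_walk t)).
  by rewrite !inE eqxx (negPf (perm_walk_high t)) => /(_ isT).
rewrite (eq_bigr _ (fun p _ => perm_walk_links p)).
under [in RHS]eq_bigr do rewrite perm_walk_visits.
under [X in (_ + _ * X = _)%N]eq_bigr do rewrite perm_walk_visits /=.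
rewrite sum_nat_const !card_prod card_bool card_ord; lia.
Qed.

Lemma perm_walk_crossing i : (0 < crossings perm_walk i (pi i))%N.
Proof.
rewrite /crossings (bigD1 (Ordinal (time_lt (true, (true, i))))) //=.
by rewrite (perm_walk_step (time_inn_inn i)) eqxx.
Qed.

End PermWalk.

(** * The walk through the low vertices *)

Section ApexWalk.
Let n_gt0 : (0 < n)%N. Proof. by lia. Qed.
Let n_gt1 : (1 < n)%N. Proof. by lia. Qed.

Definition apex_walk : {ffun 'I_n -> 'I_n} :=
  [ffun t : 'I_n => if t == 0%N :> nat then Ordinal n_gt0
   else if odd t then Ordinal n_gt1 else Ordinal n3].

Lemma apex_walk_closed : closed_walk apex_walk.
Proof.
apply/forallP=> t; apply/negP => /eqP/(congr1 (@nat_of_ord n)); rewrite !ffunE.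
have [lt|ge] := ltnP t.+1 n; last first.
  rewrite (ordS_wrap ge) eqxx; case: eqP => [t0|_]; last by case: ifP.
  by move: ge; rewrite t0; lia.
rewrite ordS_val //=; case: eqP => [->|_] //=.
by case: odd.
Qed.

Lemma apex_walk_min : min_start apex_walk.
Proof.
apply/forallP=> t; apply/forallP=> t'; apply/implyP=> /andP[t'0 t0].
by rewrite !ffunE t'0 (negPf t0); case: odd.
Qed.

Lemma apex_walk_low : low_walk apex_walk.
Proof.
move=> t; apply/forall_inP => v; rewrite !inE => /orP[]/eqP->; rewrite ffunE /low;
  by case: ifP => _; [|case: ifP].
Qed.

(** Its variable plays [z]: gadget walks have no low vertex and so cannot use it. *)
Definition apex_edge : {set 'I_n} := [set Ordinal n_gt1; Ordinal n3].

Lemma apex_walk_edge : (0 < \sum_t (step apex_walk t == apex_edge))%N.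
Proof.
rewrite (bigD1 (Ordinal n_gt1)) //= (_ : step _ _ = apex_edge) ?eqxx //.
by rewrite /step !ffunE ordS_val.
Qed.

End ApexWalk.
End Gadget.

Lemma Clow_perm_size (S : comNzSemiRingType) (le : S -> S -> Prop) m k j :
  totally_ordered_semiring le -> (2 <= q)%N -> (4 * k + 6 <= n)%N ->
  (0 < j < k)%N -> mono_aff_proj le (Clow S q n) (Permanent S m) ->
  ('C(k, j) <= m)%N.
Proof.
move=> hS q2 kn jk proj.
have q1 : (0 < q - 1)%N by rewrite subn_gt0.
have n3 : (2 < n)%N by lia.
have [enc [enc_inj enc_ge]] : exists enc : bool * (bool * 'I_k) -> 'I_n,
    injective enc /\ forall x, (6 <= enc x)%N.
  have lt x : (6 + @enum_rank (bool * (bool * 'I_k))%type x < n)%N.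
    have /leq_trans := ltn_ord (enum_rank x).
    move=> /(_ (4 * k)%N) H; rewrite -[n](subnK (leq_trans (leq_addl _ 6) kn)).
    rewrite addnC ltn_add2r (leq_trans (H _)) //; last by lia.
    by rewrite !card_prod card_bool card_ord; lia.
  exists (fun x => Ordinal (lt x)); split=> [x y /(congr1 (@nat_of_ord n)) /=|x].
    by move=> /eqP; rewrite eqn_add2l => /eqP E; apply/enum_rank_inj/val_inj.
  exact: leq_addr.
have [E EP] := proj_perm_matchings hS (@support_Clow S) proj.
have wtE w : closed_walk w -> wt (clow_weight enc) (clow_mon w) =
  (reward enc w * (q - 1))%N%:Z - (cost enc w * (q - 1))%N%:Z.
  by move=> cw; apply: clow_weightE.
have wt0 w : closed_walk w -> reward enc w = cost enc w ->
    wt (clow_weight enc) (clow_mon w) = 0.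
  by move=> cw rc; rewrite wtE // rc subrr.
have /fin_all_exists[rho rhoE] (x : 'I_k * 'I_k) :
    exists e : edge n, val e = cross enc x.1 x.2.
  by apply: edge_exists; rewrite (inj_eq enc_inj).
have [z zE] : exists e : edge n, val e = apex_edge n3 by apply: edge_exists.
have crossE w x : clow_mon w (inl (rho x)) = (crossings enc w x.1 x.2 * (q - 1))%N.
  by rewrite ffunE rhoE.
(* The maximum 0 is attained exactly when reward equals cost. *)
apply: (perm_size_bound (w := clow_weight enc) (beta := 0) (z := inl z)
   (rho := fun x => inl (rho x)) EP _ q1) jk.
- move=> _ [w /andP[cw _] ->]; rewrite wtE // subr_le0 lez_nat leq_mul2r.
  by have [-> _] := reward_le_cost enc_inj enc_ge n3 cw; rewrite orbT.
- move=> x y [] /(congr1 val); rewrite !rhoE => /setP xy.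
  have := xy (inn enc (true, x.1)); have := xy (inn enc (false, x.2)).
  rewrite !inE !eqxx !(inj_eq enc_inj) !xpair_eqE /= ?orbT ?orbF.
  by move=> /esym/eqP e2 /esym/eqP e1; apply/eqP; rewrite -[x == y]/(_ && _) e1 e2 !eqxx.
- move=> _ [w /andP[cw _] ->]; rewrite wtE // => /eqP; rewrite subr_eq0 eqz_nat.
  rewrite eqn_pmul2r // => /eqP rc.
  have [_ /(_ rc)[lo|gw]] := reward_le_cost enc_inj enc_ge n3 cw.
    left=> x; rewrite crossE /crossings big1 // => t _; case: eqP => // st.
    have /forall_inP/(_ (inn enc (true, x.1))) := lo t.
    rewrite st !inE eqxx /low => /(_ isT).
    by rewrite ltnNge (leq_trans _ (enc_ge _)).
  right; split.
    rewrite ffunE zE big1 // => t _; case: eqP => // st.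
    have [_ hi _] := gw; have: w t \in apex_edge n3 by rewrite -st !inE eqxx.
    by have := hi t; rewrite !inE /low; case: eqP => [->|_] //; case: eqP => [->|].
  have [pi piE] := gadget_walk_perm enc_inj n3 cw gw.
  by exists pi => x; rewrite crossE piE.
- exists (clow_mon (apex_walk n3)); split.
  + by exists (apex_walk n3) => //; rewrite apex_walk_closed apex_walk_min.
  + apply: wt0 (apex_walk_closed _) _; apply: low_walk_tight => //.
      exact: apex_walk_closed.
    exact: apex_walk_low.
  + by rewrite ffunE zE muln_gt0 apex_walk_edge.
- move=> pi; exists (clow_mon (perm_walk enc n3 kn pi)); split.
  + by exists (perm_walk enc n3 kn pi); rewrite ?perm_walk_closed ?perm_walk_min.
  + apply: wt0; first exact: perm_walk_closed.
    exact: perm_walk_tight.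
  + by move=> i; rewrite crossE muln_gt0 perm_walk_crossing.
Qed.

End Clow.

(** * Asymptotics *)

(** Pascal's rule writes the next central coefficient as a sum of two, each at least the current
    one. *)
Lemma central_bin j : (2 ^ j <= 'C(2 * j, j))%N.
Proof.
elim: j => // j IH; rewrite mulnS !addSn add0n binS expnS mul2n -addnn.
apply: leq_add; apply: leq_trans IH _; last by apply: leq_bin2l; lia.
by rewrite binS leq_addl.
Qed.

Lemma Sat_pow2 (S : comNzSemiRingType) (le : S -> S -> Prop) q n m j :
  totally_ordered_semiring le -> (2 <= q)%N -> (0 < j)%N ->
  (4 * j ^ 2 + 2 <= n)%N ->
  mono_aff_proj le (Sat S q n) (Permanent S m) -> (2 ^ j <= m)%N.
Proof.
(* The instance is k = 2 j, so that [central_bin] applies and [k * k] is [4 * j ^ 2]. *)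
move=> hS q2 j0 jn proj; apply: leq_trans (central_bin j) _.
apply: (Sat_perm_size hS q2 _ _ proj); last by lia.
by apply: leq_trans jn; rewrite leq_add2r mulnACA mulnn.
Qed.

Lemma Clow_pow2 (S : comNzSemiRingType) (le : S -> S -> Prop) q n m j :
  totally_ordered_semiring le -> (2 <= q)%N -> (0 < j)%N ->
  (8 * j + 6 <= n)%N ->
  mono_aff_proj le (Clow S q n) (Permanent S m) -> (2 ^ j <= m)%N.
Proof.
move=> hS q2 j0 jn proj; apply: leq_trans (central_bin j) _.
by apply: (Clow_perm_size hS q2 _ _ proj); lia.
Qed.

Lemma exists_pow2_gt_poly A d N : exists2 j, (N < j)%N & (A * j ^ d + A < 2 ^ j)%N.
Proof.
(* With j = 4^u the polynomial is at most a power of two with exponent linear in u, while 4^u >= (u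
   + 1)^2 exceeds that exponent by the choice of u. *)
pose u := (2 * d + A + 1 + N)%N; exists (2 ^ (2 * u))%N.
  by apply: leq_trans (ltn_expl _ (ltnSn 1)); rewrite ltnS /u; lia.
have j0 : (0 < 2 ^ (2 * u))%N by rewrite expn_gt0.
have hA : (A * (2 ^ (2 * u)) ^ d + A <= 2 ^ (A + 2 * u * d).+1)%N.
  rewrite expnS [(2 * 2 ^ _)%N]mul2n -addnn expnD -expnM leq_add //.
    by rewrite leq_mul // ltnW // ltn_expl.
  by rewrite -[X in (X <= _)%N]muln1 leq_mul ?expn_gt0 // ltnW // ltn_expl.
apply: leq_ltn_trans hA _; rewrite ltn_exp2l //.
have uu : (u < 2 ^ u)%N by apply: ltn_expl.
rewrite mul2n -addnn expnD; have := leq_mul uu uu.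
have : (u * (2 * d + A + 1) <= u * u)%N by rewrite leq_mul2l /u; lia.
have : (A <= u * A)%N by rewrite leq_pmull // /u; lia.
lia.
Qed.

(** A polynomial bound on [t] would bound 2^j by a polynomial in j, as n is of order at most j^2.
    The factor 14 covers both [4 * j ^ 2 + 2] and [8 * j + 6]. *)
Lemma not_poly_bounded (t : nat -> nat) (N : nat) :
  (forall j, (N < j)%N -> exists2 n, (n <= 14 * j ^ 2)%N & (2 ^ j <= t n)%N) ->
  ~ poly_bounded t.
Proof.
move=> big [K [C tC]].
have [j Nj] := exists_pow2_gt_poly (C * 14 ^ K) (2 * K) N.
have [n nj /leq_trans/(_ (tC n)) tn] := big j Nj.
rewrite ltnNge => /negP; apply; apply: leq_trans tn _; apply: leq_add.
  rewrite -mulnA leq_mul // expnM -expnMn.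
  by case: (posnP K) => [->|K0]; rewrite ?expn0 // leq_exp2r.
by rewrite leq_pmulr // expn_gt0.
Qed.

Lemma pow2_leP (x : Rdefinitions.R) j m : (2 ^ j <= m)%N ->
  Rdefinitions.Rle x (Raxioms.INR j) -> pow2_le x m.
Proof.
move=> jm xj; have powE : Raxioms.INR (2 ^ j)%N =
    Rpower.Rpower (Raxioms.INR 2) (Raxioms.INR j).
  rewrite Rpower.Rpower_pow; last by rewrite /=; lra.
  elim: j {jm xj} => // j IH; rewrite expnS [LHS]RIneq.mult_INR IH.
  by rewrite /=; lra.
apply: (RIneq.Rle_trans _ (Raxioms.INR (2 ^ j)%N)); last first.
  by apply: RIneq.le_INR; apply/ssrnat.leP.
rewrite powE; apply: Rpower.Rle_Rpower => //; rewrite /=; lra.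
Qed.

(** Take the largest [j] with [4 * j ^ 2 + 2 <= n]; then n < 4 (j + 1)^2 + 2 <= 18 j^2. The weaker
    factor 25 is a perfect square and gives the constant 1/5. *)
Lemma exists_sqrt_scale n : (6 <= n)%N ->
  exists2 j, (0 < j)%N & (4 * j ^ 2 + 2 <= n <= 25 * j ^ 2)%N.
Proof.
move=> n6; have ex : exists j, (4 * j ^ 2 + 2 <= n)%N by exists 1%N.
have bnd j : (4 * j ^ 2 + 2 <= n)%N -> (j <= n)%N by rewrite expnS expn1; nia.
case: (ex_maxnP ex bnd) => j jn jmax.
have j0 : (0 < j)%N by apply: jmax.
have lt : (n < 4 * j.+1 ^ 2 + 2)%N.
  by rewrite ltnNge; apply/negP => /jmax; rewrite ltnn.
by exists j => //; rewrite jn /=; move: lt; rewrite !expnS !expn0; nia.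
Qed.

Lemma sqrt_scale n j : (n <= 25 * j ^ 2)%N ->
  Rdefinitions.Rle (Rdefinitions.Rmult (Rdefinitions.Rinv (Raxioms.INR 5))
     (R_sqrt.sqrt (Raxioms.INR n))) (Raxioms.INR j).
Proof.
move=> nj.
have le : Rdefinitions.Rle (R_sqrt.sqrt (Raxioms.INR n)) (Raxioms.INR (5 * j)%N).
  rewrite -(R_sqrt.sqrt_square (Raxioms.INR (5 * j)%N)); last exact: RIneq.pos_INR.
  apply: R_sqrt.sqrt_le_1_alt; rewrite -RIneq.mult_INR; apply: RIneq.le_INR.
  by apply/ssrnat.leP; apply: leq_trans nj _; rewrite expnS expn1; nia.
move: le; rewrite [Raxioms.INR (5 * j)%N]RIneq.mult_INR.
by rewrite [Raxioms.INR 5]RIneq.INR_IZR_INZ /=; lra.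
Qed.

Theorem theorem2 (q : nat) (hq : (2 <= q)%N)
    (S : comNzSemiRingType) (le : S -> S -> Prop)
    (hS : totally_ordered_semiring le) :
  (* not monotone affine p-projections of the permanent *)
  ~ (exists t, poly_bounded t /\
       eventually (fun n => mono_aff_proj le (Sat S q n) (Permanent S (t n)))) /\
  ~ (exists t, poly_bounded t /\
       eventually (fun n => mono_aff_proj le (Clow S q n) (Permanent S (t n)))) /\
  (* blow-up 2^Omega(sqrt n) for Sat^q *)
  (forall t : nat -> nat,
     eventually (fun n => mono_aff_proj le (Sat S q n) (Permanent S (t n))) ->
     exists c, Rpos c /\
       eventually (fun n =>
         pow2_le (Rdefinitions.Rmult c (R_sqrt.sqrt (Raxioms.INR n))) (t n))) /\
  (* blow-up 2^Omega(n) for Clow^q *)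
  (forall t : nat -> nat,
     eventually (fun n => mono_aff_proj le (Clow S q n) (Permanent S (t n))) ->
     exists c, Rpos c /\
       eventually (fun n => pow2_le (Rdefinitions.Rmult c (Raxioms.INR n)) (t n))).
Proof.
have invR k : (0 < k)%N -> Rpos (Rdefinitions.Rinv (Raxioms.INR k)).
  move=> k0; rewrite /Rpos [Raxioms.INR 0]/=; apply: RIneq.Rinv_0_lt_compat.
  by apply: RIneq.lt_0_INR; apply/ssrnat.ltP.
split; last split; last split.
- move=> [t [poly [N proj]]]; apply: (@not_poly_bounded t N) poly => j Nj.
  have jj : (j <= j ^ 2)%N by rewrite expnS expn1 leq_pmulr; lia.
  exists (4 * j ^ 2 + 2)%N; first by lia.
  apply: (Sat_pow2 hS hq _ (leqnn _)); first by lia.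
  by apply: proj; lia.
- move=> [t [poly [N proj]]]; apply: (@not_poly_bounded t N) poly => j Nj.
  have jj : (j <= j ^ 2)%N by rewrite expnS expn1 leq_pmulr; lia.
  exists (8 * j + 6)%N; first by lia.
  apply: (Clow_pow2 hS hq _ (leqnn _)); first by lia.
  by apply: proj; lia.
- move=> t [N proj]; exists (Rdefinitions.Rinv (Raxioms.INR 5)); split.
    exact: invR.
  exists (N + 6)%N => n Nn; have [|j j0 /andP[jn nj]] := @exists_sqrt_scale n.
    by lia.
  apply: pow2_leP (sqrt_scale nj); apply: (Sat_pow2 hS hq j0 jn).
  by apply: proj; lia.
- move=> t [N proj]; exists (Rdefinitions.Rinv (Raxioms.INR 22)); split.
    exact: invR.
  (* Starting at 14 makes j >= 1, so n < 8 j + 14 <= 22 j, whence the constant 1/22. *)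
  exists (N + 14)%N => n Nn; pose j := ((n - 6) %/ 8)%N.
  have j0 : (0 < j)%N by rewrite divn_gt0; lia.
  have jn : (8 * j + 6 <= n)%N.
    by have := leq_trunc_div (n - 6) 8; rewrite -/j; lia.
  have nj : (n <= 22 * j)%N.
    by have := ltn_ceil (n - 6) (isT : 0 < 8)%N; rewrite -/j; lia.
  apply: (@pow2_leP _ j); first by apply: (Clow_pow2 hS hq j0 jn); apply: proj; lia.
  have : Rdefinitions.Rle (Raxioms.INR n) (Raxioms.INR (22 * j)%N).
    by apply: RIneq.le_INR; apply/ssrnat.leP.
  rewrite RIneq.mult_INR.
  by rewrite [Raxioms.INR 22]RIneq.INR_IZR_INZ /=; lra.
Qed.
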